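(* Let $(X,\mu,T)$ be a measure-preserving system and let $\rho$ and $\omega$ be two admissible generating semimetrics on $(X,\mu)$ with finite integrals over $(X^2,\mu^2)$. Then $$\mathcal{H}(X,\mu,T,\rho)=\mathcal{H}(X,\mu,T,\omega),$$ where $\mathcal{H}(X,\mu,T,\rho)$ denotes the scaling entropy of $(X,\mu,T)$ with respect to the semimetric $\rho$.
   Context: A measure-preserving system $(X,\mu,T)$ is a standard probability space $(X,\mu)$ with an invertible measure-preserving transformation $T$; $\mathbb{N}=\{1,2,\dots\}$. A measurable semimetric on $(X,\mu)$ is a symmetric non-negative measurable function $\rho$ on $(X^2,\mu^2)$ satisfying the triangle inequality. $\varepsilon$-entropy: for $\varepsilon>0$, let $k$ be the minimal positive integer such that $X$ decomposes into a union of measurable sets $X_0,X_1,\dots,X_k$ with $\mu(X_0)<\varepsilon$ and $\operatorname{diam}_\rho(X_i)<\varepsilon$ for all $i>0$; put $\mathbb{H}_\varepsilon(X,\mu,\rho)=\log_2 k$, and $\mathbb{H}_\varepsilon(X,\mu,\rho)=+\infty$ if no such $k$ exists. A semimetric $\rho$ is admissible if $\mathbb{H}_\varepsilon(X,\mu,\rho)<+\infty$ for all $\varepsilon>0$. Averaged semimetric: $T_{av}^n\rho(x,y)=\frac1n\sum_{k=0}^{n-1}\rho(T^kx,T^ky)$. A semimetric $\rho$ is generating (for $T$) if there is a set $X'\subset X$ of full measure such that for any distinct $x,y\in X'$ there is $n\in\mathbb{N}$ with $T_{av}^n\rho(x,y)>0$. For sequences $\phi,\psi$ of non-negative reals, $\phi\lesssim\psi$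 means there is $C>0$ with $\phi(n)\le C\psi(n)$ for all $n\in\mathbb{N}$. For functions $\Phi,\Psi:\mathbb{N}\times(0,\infty)\to[0,\infty)$ (non-strictly) decreasing in their second argument, write $\Phi\preceq\Psi$ if for every $\varepsilon>0$ there is $\delta>0$ such that $\Phi(n,\varepsilon)\lesssim\Psi(n,\delta)$ (as sequences in $n$), and $\Phi\sim\Psi$ if $\Phi\preceq\Psi$ and $\Psi\preceq\Phi$; $[\Phi]$ denotes the equivalence class of $\Phi$ under $\sim$. For an admissible semimetric $\rho$, the scaling entropy of $(X,\mu,T)$ with respect to $\rho$ is the class $\mathcal{H}(X,\mu,T,\rho)=[\,(n,\varepsilon)\mapsto\mathbb{H}_\varepsilon(X,\mu,T_{av}^n\rho)\,]$. *)

(* Defs.v *)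
From HB Require Import structures.
From mathcomp Require Import all_boot all_order all_algebra.
From mathcomp Require Import all_classical all_reals all_analysis.
From mathcomp Require Import measurable_realfun.

Set Implicit Arguments.
Unset Strict Implicit.
Unset Printing Implicit Defensive.

Import Order.TTheory GRing.Theory Num.Theory.
Import numFieldNormedType.Exports.

Local Open Scope classical_set_scope.
Local Open Scope ring_scope.
Local Open Scope ereal_scope.

(* [f] is an isomorphism modulo null sets from [(X, mu)] to the real line with
   a Borel probability measure [nu]. Images are only required to be measurable
   for the completion of [nu], so that both standard Borel probability spaces
   and complete (Lebesgue-Rokhlin) spaces are covered. Taking [A := X0] in the
   last clause shows that [f @` X0] has full measure. *)
Definition standard_probability d (X : measurableType d) (R : realType)
    (mu : probability X R) : Prop :=
  exists (nu : probability (measurableTypeR R) R) (X0 : set X) (f : X -> R),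
    [/\ measurable X0 /\ mu X0 = 1,
        measurable_fun X0 f,
        {in X0 &, injective f},
        forall B : set R, measurable B -> mu (X0 `&` f @^-1` B) = nu B
      & forall A : set X, measurable A -> A `<=` X0 ->
          completed_algebra_gen nu (f @` A)].

Definition invertible_measure_preserving d (X : measurableType d)
    (R : realType) (mu : probability X R) (T : X -> X) : Prop :=
  [/\ measurable_fun setT T,
      exists S : X -> X, [/\ measurable_fun setT S, cancel T S & cancel S T]
    & forall A : set X, measurable A -> mu (T @^-1` A) = mu A].

(* Measurability on [(X^2, mu^2)] refers to the completed product
   sigma-algebra; it is implied by measurability for the product sigma-algebra
   itself. *)
Definition measurable_semimetric d (X : measurableType d) (R : realType)
    (mu : probability X R) (rho : X -> X -> R) : Prop :=
  [/\ forall x y, rho x y = rho y x,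
      forall x y, (0 <= rho x y)%R,
      forall x y z, (rho x z <= rho x y + rho y z)%R
    & forall B : set R, measurable B ->
        completed_algebra_gen (mu \x mu)
          [set p : X * X | B (rho p.1 p.2)]].

(* The maximum with [0] makes the diameter of the empty set equal to [0]. *)
Definition diam (X : Type) (R : realType) (rho : X -> X -> R) (A : set X)
    : \bar R :=
  maxe 0 (ereal_sup [set (rho p.1 p.2)%:E | p in A `*` A]).

Definition has_decomposition d (X : measurableType d) (R : realType)
    (mu : probability X R) (rho : X -> X -> R) (eps : R) (k : nat) : Prop :=
  (0 < k)%N /\
  exists A : nat -> set X,
    [/\ forall i, (i <= k)%N -> measurable (A i),
        \bigcup_(i in [set i | (i <= k)%N]) A i = setT,
        mu (A 0%N) < eps%:E
      & forall i, (0 < i <= k)%N -> diam rho (A i) < eps%:E].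

Definition log2 (R : realType) (x : R) : R := (ln x / ln 2)%R.

Definition epsilon_entropy d (X : measurableType d) (R : realType)
    (mu : probability X R) (rho : X -> X -> R) (eps : R) : \bar R :=
  match pselect (exists k, `[< has_decomposition mu rho eps k >]) with
  | left h => (log2 (ex_minn h)%:R)%:E
  | right _ => +oo
  end.

Definition admissible d (X : measurableType d) (R : realType)
    (mu : probability X R) (rho : X -> X -> R) : Prop :=
  forall eps : R, (0 < eps)%R -> epsilon_entropy mu rho eps < +oo.

Definition averaged (X : Type) (R : realType) (T : X -> X) (n : nat)
    (rho : X -> X -> R) (x y : X) : R :=
  (n%:R^-1 * \sum_(k < n) rho (iter k T x) (iter k T y))%R.

Definition generating d (X : measurableType d) (R : realType)
    (mu : probability X R) (T : X -> X) (rho : X -> X -> R) : Prop :=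
  exists X' : set X, [/\ measurable X', mu X' = 1
    & forall x y, X' x -> X' y -> x <> y ->
        exists2 n : nat, (0 < n)%N & (0 < averaged T n rho x y)%R].

Definition finite_integral d (X : measurableType d) (R : realType)
    (mu : probability X R) (rho : X -> X -> R) : Prop :=
  \int[mu \x mu]_(p in [set: X * X]) (rho p.1 p.2)%:E < +oo.

(* Sequences are indexed by the positive integers. *)
Definition seq_lesssim (R : realType) (phi psi : nat -> \bar R) : Prop :=
  exists2 C : R, (0 < C)%R & forall n, (0 < n)%N -> phi n <= C%:E * psi n.

Definition entropy_function (R : realType) (Phi : nat -> R -> \bar R) : Prop :=
  forall n, (0 < n)%N ->
    (forall eps : R, (0 < eps)%R -> 0 <= Phi n eps) /\
    (forall eps1 eps2 : R, (0 < eps1)%R -> (eps1 <= eps2)%R ->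
       Phi n eps2 <= Phi n eps1).

Definition fun_preceq (R : realType) (Phi Psi : nat -> R -> \bar R) : Prop :=
  forall eps : R, (0 < eps)%R -> exists2 delta : R, (0 < delta)%R &
    seq_lesssim (Phi ^~ eps) (Psi ^~ delta).

Definition fun_equiv (R : realType) (Phi Psi : nat -> R -> \bar R) : Prop :=
  fun_preceq Phi Psi /\ fun_preceq Psi Phi.

(* The values of [Phi] at [n = 0] or [eps <= 0] are irrelevant. Values in
   [[0, +oo]] are allowed, but when [Phi] is finite for [n > 0] and [eps > 0]
   so is every member of its class, since [fun_preceq Psi Phi] bounds [Psi] by
   finite quantities. *)
Definition equiv_class (R : realType) (Phi : nat -> R -> \bar R)
    : set (nat -> R -> \bar R) :=
  [set Psi | entropy_function Psi /\ fun_equiv Phi Psi].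

Definition scaling_entropy d (X : measurableType d) (R : realType)
    (mu : probability X R) (T : X -> X) (rho : X -> X -> R)
    : set (nat -> R -> \bar R) :=
  equiv_class (fun n eps => epsilon_entropy mu (averaged T n rho) eps).

(* Main.v *)
(* The semimetric omega is generating and mu is standard, so countably many
   preimages under iterates of T of omega-balls separate points, and by
   compactness every measurable set is determined, up to a set of small measure,
   by finitely many of them. Applied to the pieces of a decomposition for rho,
   this shows that off a set of small measure rho (x, y) is small as soon as
   finitely many omega (T^k x, T^k y) are small. Truncation upgrades this to
   rho (x, y) <= a + L * sum_(k < m) omega (T^k x, T^k y) + g x + g y with g of
   small integral. Averaging along orbits preserves the integral of g, so by
   Markov's inequality a decomposition for T_av^n omega yields one of the same
   cardinality for T_av^n rho, once n is large. The finitely many remaining n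
   only affect the multiplicative constant. *)

Require Import Defs.
From mathcomp Require Import all_boot all_order all_algebra.
From mathcomp Require Import all_classical all_reals all_analysis.
From mathcomp Require Import measurable_realfun.
From mathcomp Require Import lra ring.

Set Implicit Arguments.
Unset Strict Implicit.
Unset Printing Implicit Defensive.

Import Order.TTheory GRing.Theory Num.Theory.
Import numFieldNormedType.Exports.

Local Open Scope classical_set_scope.
Local Open Scope ring_scope.
Local Open Scope ereal_scope.

(** * Measure estimates *)

(** No pointwise relation between [rho] and [omega] is given, so any comparison has an exceptional
    set. An orbit may visit that set at a positive fraction of times, and [rho] may be unbounded
    there. Integrability answers this: by Fubini some base point has an integrable distance function
    [r], and the triangle inequality gives [rho x y <= r x + r y] almost everywhere. The truncation
    level of [r] is fixed first; only then is the exceptional set made so small that its share in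
    the integral of [g] is negligible. Semimetrics are measurable only for the completed product;
    admissibility restores product measurability on the square of a set of full measure, so that
    sections and Tonelli are available. For a fixed small [n] a constant cannot repair a zero
    right-hand side. Since an entropy is the logarithm of an integer, it is either zero or at least
    1, and only the case where it is zero at every scale needs another argument. *)

Lemma measure_lt_sub d (X : measurableType d) (R : realType)
    (mu : {measure set X -> \bar R}) (A B : set X) (e : \bar R) :
  measurable A -> measurable B -> A `<=` B -> mu B < e -> mu A < e.
Proof. by move=> mA mB AB; apply: le_lt_trans; rewrite le_measure ?inE. Qed.

Lemma measureU_lt d (X : measurableType d) (R : realType)
    (mu : {measure set X -> \bar R}) (A B : set X) (a b : R) :
  measurable A -> measurable B -> mu A < a%:E -> mu B < b%:E ->
  mu (A `|` B) < (a + b)%:E.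
Proof.
move=> mA mB Aa Bb; apply: (le_lt_trans (measureU2 _ _ _)) => //.
by rewrite EFinD; apply: lteD.
Qed.

Lemma measure_bigcup_le d (X : measurableType d) (R : realType)
    (mu : {measure set X -> \bar R}) (D : (set X)^nat) (e : R) :
  (0 <= e)%R -> (forall n, measurable (D n)) ->
  (forall n, mu (D n) <= (e / (2 ^ n.+1)%:R)%:E) -> mu (\bigcup_n D n) <= e%:E.
Proof.
move=> e0 mD De; apply: (@le_trans _ _ (\sum_(n <oo) mu (D n))).
  by apply: measure_sigma_subadditive => //; exact: bigcupT_measurable.
apply: le_trans (epsilon_trick0 xpredT e0).
by apply: lee_nneseries => // n _; exact: measure_ge0.
Qed.

Lemma measure_nonincreasing_lt d (X : measurableType d) (R : realType)
    (mu : probability X R) (D : (set X)^nat) (e : R) :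
  (0 < e)%R -> (forall n, measurable (D n)) ->
  nonincreasing_seq D -> \bigcap_n D n = set0 -> exists n, mu (D n) < e%:E.
Proof.
move=> e0 mD nD D0.
have : mu \o D @ \oo --> mu (\bigcap_n D n).
  apply: nonincreasing_cvg_mu => //.
  - by rewrite (le_lt_trans (probability_le1 _ _)) ?ltry.
  - by rewrite D0.
rewrite D0 measure0 => D_cvg.
have : \forall n \near \oo, (mu \o D) n < e%:E.
  apply: (D_cvg [set y | y < e%:E]); apply: open_nbhs_nbhs; split.
    exact: open_ereal_lt_ereal.
  by rewrite /= lte_fin.
by case=> N _ /(_ N (leqnn N)); exists N.
Qed.

Lemma probabilityU2 d (X : measurableType d) (R : realType)
    (mu : probability X R) (A B : set X) :
  measurable A -> measurable B -> mu (A `|` B) <= mu A + mu B.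
Proof. exact: measureU2. Qed.

Lemma full_setC0 d (X : measurableType d) (R : realType)
    (mu : probability X R) (A : set X) :
  measurable A -> mu A = 1 -> mu (~` A) = 0.
Proof. by move=> mA A1; rewrite probability_setC// A1 subee. Qed.

Lemma full_bigcap d (X : measurableType d) (R : realType)
    (mu : probability X R) (A : (set X)^nat) :
  (forall k, measurable (A k)) -> (forall k, mu (A k) = 1) ->
  mu (\bigcap_k A k) = 1.
Proof.
move=> mA A1; have mC k : measurable (~` A k) by exact: measurableC.
rewrite -[X in mu X]setCK setC_bigcap probability_setC; last first.
  exact: bigcup_measurable.
suff -> : mu (\bigcup_k ~` A k) = 0 by rewrite sube0.
apply/negligibleP; first exact: bigcup_measurable.
apply: negligible_bigcup => k; exists (~` A k); split => //.
exact: full_setC0.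
Qed.

Lemma full_setI d (X : measurableType d) (R : realType)
    (mu : probability X R) (A B : set X) :
  measurable A -> measurable B -> mu A = 1 -> mu B = 1 -> mu (A `&` B) = 1.
Proof.
move=> mA mB A1 B1; rewrite -bigcap2E; apply: full_bigcap.
  by case=> [|[|k]] //=.
by case=> [|[|k]] //=; rewrite probability_setT.
Qed.

(** * Approximation by compact codes *)

(** Treating [B] and its complement together makes stability under complements immediate; the sets
    with this property form a sigma-algebra containing the open left rays. *)
Lemma probability_closed_approx (R : realType)
    (nu : probability (measurableTypeR R) R) (B : set R) (e : R) :
  measurable B -> (0 < e)%R ->
  exists F F' : set R, [/\ closed F, closed F', F `<=` B, F' `<=` ~` B &
    nu (~` (F `|` F')) < e%:E].
Proof.
move=> mB; move: e.
pose C : set (set R) := [set B | forall e : R, (0 < e)%R ->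
  exists F F' : set R, [/\ closed F, closed F', F `<=` B, F' `<=` ~` B &
    nu (~` (F `|` F')) < e%:E]].
suff: C B by [].
have mcl (F : set R) : closed F -> measurable (F : set (measurableTypeR R)).
  exact: closed_measurable.
have : <<s @RGenInftyO.G R >> B.
  by have := RGenInftyO.measurableE R; rewrite /measurable/= => <-.
move: B {mB}.
apply: smallest_sub; first split.
- move=> e e0; exists set0, setT; split=> //.
  - exact: closed0.
  - by move=> x _ [].
  by rewrite setUT setCT measure0 lte_fin.
- move=> A CA e e0; rewrite setTD.
  have [F [F' [cF cF' FA F'A FF']]] := CA _ e0.
  by exists F', F; rewrite setCK setUC.
- move=> A CA e e0.
  have e20 : (0 < e / 2)%R by rewrite divr_gt0.
  have e2i i : (0 < e / 2 / (2 ^ i.+1)%:R)%R.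
    by rewrite divr_gt0// ltr0n expn_gt0.
  have /choice[F] : forall i, exists FF : set R * set R,
    [/\ closed FF.1, closed FF.2, FF.1 `<=` A i, FF.2 `<=` ~` A i &
    nu (~` (FF.1 `|` FF.2)) < (e / 2 / (2 ^ i.+1)%:R)%:E].
    by move=> i; have [F [F' ?]] := CA i _ (e2i i); exists (F, F').
  move=> /all_and5[cF cF' FA F'A FF'].
  (* An infinite union of closed sets need not be closed, so the union is cut at [N], at the cost of
     the tail [D N]. The intersection on the complementary side is closed without a cut. *)
  pose D N := (\bigcup_n (F n).1) `\` \bigcup_(n < N) (F n).1.
  have mF n : measurable ((F n).1 : set (measurableTypeR R)).
    exact: mcl.
  have mF' n : measurable ((F n).2 : set (measurableTypeR R)).
    exact: mcl.
  have mD n : measurable (D n : set (measurableTypeR R)).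
    by apply: measurableD; exact: bigcup_measurable.
  have [||N DN] := @measure_nonincreasing_lt _ _ _ nu D (e / 2) e20 mD.
  + apply/nonincreasing_seqP => n; apply/subsetPset; apply: setDS => x [k /= kn Fk].
    by exists k => //=; exact: leqW.
  + apply/seteqP; split=> // x Dx; case: (Dx 0%N I) => -[n _ Fnx] _.
    by case: (Dx n.+1 I) => _; apply; exists n => /=.
  exists (\bigcup_(n < N) (F n).1), (\bigcap_n (F n).2); split.
  + by apply: closed_bigcup => // n _; exact: cF.
  + by apply: closed_bigI => n _; exact: cF'.
  + by move=> x [n _ /FA Anx]; exists n.
  + by move=> x F'x [n _ Anx]; exact: (F'A n _ (F'x n I)).
  + have mcl1 : measurable (\bigcup_(n < N) (F n).1
      `|` \bigcap_n (F n).2 : set (measurableTypeR R)).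
      apply: measurableU; first exact: bigcup_measurable.
      exact: bigcapT_measurable.
    have mE n : measurable (~` ((F n).1 `|` (F n).2) : set (measurableTypeR R)).
      by apply: measurableC; exact: measurableU.
    rewrite [in ltRHS](splitr e).
    apply: (@measure_lt_sub _ _ _ nu _
        (\bigcup_n (~` ((F n).1 `|` (F n).2)) `|` D N)).
    * exact: measurableC.
    * by apply: measurableU => //; exact: bigcupT_measurable.
    * move=> x; rewrite setCU => -[F1 F2].
      have [[n Fn]|nF] := pselect (exists n, (F n).1 x).
        by right; split => //; exists n.
      have : exists n, ~ (F n).2 x.
        by apply: contrapT => /forallNP F2x; apply: F2 => n _; apply: contrapT.
      by move=> [n Fn]; left; exists n => // -[Fnx|//]; apply: nF; exists n.
    apply: (le_lt_trans (measureU2 _ _ _)) => //.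
      exact: bigcupT_measurable.
    rewrite EFinD; apply: lee_ltD => //.
      by rewrite ge0_fin_numE// (le_lt_trans (probability_le1 _ _)) ?ltry//;
        exact: bigcupT_measurable.
    apply: measure_bigcup_le => [|n|n]; [exact: ltW|exact: mE|exact/ltW/FF'].
- move=> _ [a ->] e e0.
  (* The strip left uncovered when the open ray is replaced by a slightly shorter closed one. *)
  pose D (n : nat) : set R := `](a - n.+1%:R^-1)%R, a[%classic.
  have [|||n Dn] := @measure_nonincreasing_lt _ _ _ nu D e e0.
  + by move=> n; exact: measurable_itv.
  + apply/nonincreasing_seqP => n; apply/subsetPset => x.
    rewrite /D /= !in_itv/= => /andP[h ->]; rewrite andbT.
    by apply: le_lt_trans h; rewrite lerD2l lerN2 lef_pV2 ?posrE// ler_nat.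
  + apply/seteqP; split => // x Dx.
    have := Dx 0%N I; rewrite /D /= in_itv/= => /andP[_ xa].
    have ax : (0 < a - x)%R by rewrite subr_gt0.
    have := Dx (Num.truncn (a - x)^-1) I; rewrite /D/= in_itv/= => /andP[+ _].
    rewrite ltNge => /negP; apply.
    rewrite lerBrDl -lerBrDr invf_ple ?posrE ?ltr0n//.
    by rewrite ltW// truncnS_gt.
  + exists `]-oo, (a - n.+1%:R^-1)%R]%classic, `[a, +oo[%classic; split.
    * exact: interval_closed.
    * exact: interval_closed.
    * move=> x /=; rewrite !in_itv/= => /le_lt_trans; apply.
      by rewrite ltrBlDr ltrDl invr_gt0.
    * by move=> x /=; rewrite !in_itv/= andbT leNgt => /negP.
    * rewrite (_ : ~` _ = D n)//; apply/seteqP; split => x; rewrite /D/= !in_itv/=.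
        by rewrite andbT => /not_orP[/negP + /negP]; rewrite -!ltNge => -> ->.
      by rewrite andbT => /andP[h1 h2]; apply/not_orP; split; apply/negP;
        rewrite -ltNge.
Qed.

Lemma closed_setX (U V : topologicalType) (A : set U) (B : set V) :
  closed A -> closed B -> closed (A `*` B).
Proof.
move=> cA cB; have -> : A `*` B = fst @^-1` A `&` snd @^-1` B by [].
by apply: closedI; apply: closed_comp => // x _; [exact: cvg_fst|exact: cvg_snd].
Qed.

Lemma probability_compact_approx (R : realType)
    (nu : probability (measurableTypeR R) R) (B : set R) (e : R) :
  measurable B -> (0 < e)%R ->
  exists K : set R, [/\ compact K, K `<=` B & nu (B `\` K) < e%:E].
Proof.
move=> mB e0.
have e20 : (0 < e / 2)%R by rewrite divr_gt0.
have [F [F' [cF cF' FB F'B FF']]] := probability_closed_approx nu mB e20.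
have mcl (G : set R) : closed G -> measurable (G : set (measurableTypeR R)).
  exact: closed_measurable.
have cI (n : nat) : closed (`[(- n%:R)%R, n%:R] : set R) by exact: interval_closed.
pose D (n : nat) : set R := ~` `[(- n%:R)%R, n%:R].
have [|||n Dn] := @measure_nonincreasing_lt _ _ _ nu D (e / 2) e20.
- by move=> n; exact: measurableC (mcl _ (cI n)).
- apply/nonincreasing_seqP => n; apply/subsetPset/subsetC => x.
  rewrite /= !in_itv/= => /andP[xn nx]; apply/andP; split.
    by apply: le_trans xn; rewrite lerN2 ler_nat.
  by apply: (le_trans nx); rewrite ler_nat.
- apply/seteqP; split => // x Dx.
  apply: (Dx (Num.truncn `|x|).+1 I); rewrite /= in_itv/= -ler_norml.
  by rewrite ltW// truncnS_gt.
exists (F `&` `[(- n%:R)%R, n%:R]); split.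
- apply: (subclosed_compact _ (@segment_compact R (- n%:R)%R n%:R)); last exact: subIsetr.
  exact: closedI cF (cI n).
- by move=> x [/FB].
- rewrite [in ltRHS](splitr e).
  apply: (le_lt_trans _ (measureU_lt _ _ FF' Dn)).
  + apply: le_measure; rewrite ?inE.
    * by apply: measurableD => //; exact: mcl (closedI cF (cI n)).
    * apply: measurableU; last exact: measurableC (mcl _ (cI n)).
      exact: measurableC (mcl _ (closedU cF cF')).
    * move=> x [Bx nFI]; have [Fx|nFx] := pselect (F x).
        by right => Ix; exact: nFI.
      by left => -[//|/F'B]; exact.
  + exact: measurableC (mcl _ (closedU cF cF')).
  + exact: measurableC (mcl _ (cI n)).
Qed.

(** Inner regularity on the line, pulled back along the coding [f]. Since [f] is injective on [X0],
    a point of [X0] whose code lies in [K] belongs to [A], so compact sets of codes serve as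
    certificates of membership. *)
Lemma standard_compact_approx d (X : measurableType d) (R : realType)
    (mu : probability X R) : standard_probability mu ->
  exists (X0 : set X) (f : X -> R), [/\ {in X0 &, injective f},
    forall K : set R, compact K -> measurable (X0 `&` f @^-1` K) &
    forall (A : set X) (e : R), measurable A -> (0 < e)%R ->
      exists K : set R, [/\ compact K, K `<=` f @` (A `&` X0) &
        mu (A `\` (X0 `&` f @^-1` K)) < e%:E]].
Proof.
move=> [nu [X0 [f [[mX0 muX0] mf injf nuE fA]]]].
exists X0, f; split => // [K cK|A e mA e0].
  by apply: mf => //; apply: closed_measurable; exact: compact_closed.
(* The image is measurable only for the completion: it is a Borel set [B] up to a part of the null
   set [N'], and [K] is taken inside [B]. *)
have [B mB [N [N' [mN' N'0 NN']]] BN] :=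
  fA (A `&` X0) (measurableI _ _ mA mX0) (@subIsetr _ _ _).
have [K [cK KB BK]] := probability_compact_approx nu mB e0.
have mK : measurable K by apply: closed_measurable; exact: compact_closed.
exists K; split => //.
  by apply: (subset_trans KB); rewrite -BN; exact: subsetUl.
have mN : measurable (X0 `&` f @^-1` N') by exact: mf.
have mBK : measurable (X0 `&` f @^-1` (B `\` K)).
  by apply: mf => //; exact: measurableD.
have X00 : mu (~` X0) = 0 by rewrite probability_setC// muX0 subee.
have null : mu (~` X0 `|` X0 `&` f @^-1` N') = 0.
  apply/eqP; rewrite eq_le measure_ge0 andbT.
  apply: le_trans (probabilityU2 _ _ _) _ => //; first exact: measurableC.
  by rewrite X00 nuE// N'0 adde0.
apply: (@measure_lt_sub _ _ _ mu _
   (~` X0 `|` X0 `&` f @^-1` N' `|` X0 `&` f @^-1` (B `\` K))).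
- by apply: measurableD => //; apply: mf.
- by do !apply: measurableU => //; exact: measurableC.
- move=> x [Ax XKx]; have [X0x|X0x] := pselect (X0 x); last by left; left.
  have : (B `|` N) (f x) by rewrite BN; exists x.
  move=> [Bfx|Nfx].
    by right; split => //; split => // Kfx; apply: XKx.
  by left; right; split => //; exact: NN'.
- apply: (le_lt_trans (probabilityU2 _ _ _)) => //.
    by apply: measurableU => //; exact: measurableC.
  by rewrite null add0e nuE//; exact: measurableD.
Qed.

(* If all pairs of a compact set of [A]-codes and [~` A]-codes agreed on every
   initial block of the [B n], compactness would give two distinct points which
   no [B n] separates. *)
Lemma standard_separating d (X : measurableType d) (R : realType)
    (mu : probability X R) (X' : set X) (B : (set X)^nat) :
  standard_probability mu -> measurable X' -> mu X' = 1 ->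
  (forall n, measurable (B n)) ->
  (forall x y, X' x -> X' y -> (forall n, B n x <-> B n y) -> x = y) ->
  forall (A : set X) (e : R), measurable A -> (0 < e)%R ->
  exists (M : nat) (E : set X), [/\ measurable E, mu E < e%:E &
    forall x y, ~ E x -> ~ E y -> (forall n, (n < M)%N -> B n x <-> B n y) ->
      A x -> A y].
Proof.
move=> hmu mX' X'1 mB sepB A e mA e0.
have [X0 [f [injf mf approx]]] := standard_compact_approx hmu.
have e40 : (0 < e / 4)%R by rewrite divr_gt0.
have ei i : (0 < e / 4 / (2 ^ i.+1)%:R)%R by rewrite divr_gt0// ltr0n expn_gt0.
have [K [cK KA muK]] := approx (A `&` X') _ (measurableI _ _ mA mX') e40.
have [K' [cK' K'A muK']] := approx (~` A `&` X') _
  (measurableI _ _ (measurableC mA) mX') e40.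
have /choice[L] : forall n, exists LL : set R * set R,
    [/\ compact LL.1, compact LL.2, LL.1 `<=` f @` (B n `&` X0) /\
      LL.2 `<=` f @` (~` B n `&` X0),
    mu (B n `\` (X0 `&` f @^-1` LL.1)) < (e / 4 / (2 ^ n.+1)%:R)%:E &
    mu (~` B n `\` (X0 `&` f @^-1` LL.2)) < (e / 4 / (2 ^ n.+1)%:R)%:E].
  move=> n; have [L1 [? ? ?]] := approx _ _ (mB n) (ei n).
  have [L2 [? ? ?]] := approx _ _ (measurableC (mB n)) (ei n).
  by exists (L1, L2).
move=> /all_and5[cL1 cL2 /all_and2[L1B L2B] muL1 muL2].
pose g (S : set R) := X0 `&` f @^-1` S.
pose D1 n := B n `\` g (L n).1.
pose D2 n := ~` B n `\` g (L n).2.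
pose E1 := (A `&` X') `\` g K.
pose E2 := (~` A `&` X') `\` g K'.
have mD1 n : measurable (D1 n) by apply: measurableD => //; exact: mf.
have mD2 n : measurable (D2 n).
  by apply: measurableD; [exact: measurableC|exact: mf].
have mE1 : measurable E1.
  by apply: measurableD; [exact: measurableI|exact: mf].
have mE2 : measurable E2.
  apply: measurableD; [apply: measurableI => //; exact: measurableC|exact: mf].
(* Pairs of codes certified to lie on the same side of [B n]. Closedness makes the complements an
   open cover of the product of [K] and [K']: a pair in every [V n] would come from points that no
   [B n] separates, one in [A] and one outside. *)
pose V n := (L n).1 `*` (L n).1 `|` (L n).2 `*` (L n).2.
have cV n : closed (V n).
  by apply: closedU; apply: closed_setX; apply: compact_closed.
have := compact_setX cK cK'; rewrite compact_near_coveringP.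
move=> /(_ nat \oo (fun M p => exists2 n, (n < M)%N & ~ V n p)); case.
  move=> [_ _] /= [/KA[x [[Ax X'x] X0x] <-] /K'A[y [[Ay X'y] X0y] <-]].
  suff [n nV] : exists n, ~ V n (f x, f y).
    exists (~` V n, [set M | (n < M)%N]) => /=; last by move=> [p M] /= [? ?]; exists n.
    split; last by exists n.+1.
    by apply: open_nbhs_nbhs; split => //; rewrite openC.
  apply: contrapT => nV; apply: Ay; rewrite -(sepB x y)// => n.
  have : V n (f x, f y) by apply: contrapT => Vn; apply: nV; exists n => /=.
  move=> [[/L1B[x' [Bx' X0x'] /injf xx'] /L1B[y' [By' X0y'] /injf yy']]|
          [/L2B[x' [Bx' X0x'] /injf xx'] /L2B[y' [By' X0y'] /injf yy']]].
    by rewrite -xx' ?inE// -yy' ?inE.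
  by move: Bx' By'; rewrite xx' ?inE// yy' ?inE// => /= ? ?; split.
move=> M _ /(_ M (leqnn M)) FV; exists M.
(* Outside this set every point has its code in [K] or [K'], and in the compact set for its side of
   each [B n]. The four families [E1], [E2], [D1], [D2] cost at most [e / 4] each. *)
exists (~` X' `|` (E1 `|` E2) `|` (\bigcup_n D1 n `|` \bigcup_n D2 n)).
have mE12 : measurable (E1 `|` E2) by exact: measurableU.
have mD12 : measurable (\bigcup_n D1 n `|` \bigcup_n D2 n).
  by apply: measurableU; exact: bigcupT_measurable.
have mX'E : measurable (~` X' `|` (E1 `|` E2)).
  by apply: measurableU => //; exact: measurableC.
split.
- exact: measurableU.
- apply: (le_lt_trans (probabilityU2 _ _ _)) => //.
  have muD12 : mu (\bigcup_n D1 n `|` \bigcup_n D2 n) <= (e / 4 + e / 4)%:E.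
    apply: (le_trans (probabilityU2 _ _ _)); try exact: bigcupT_measurable.
    rewrite EFinD leeD//.
      by apply: measure_bigcup_le => // [|n]; [exact: ltW|exact/ltW/muL1].
    by apply: measure_bigcup_le => // [|n]; [exact: ltW|exact/ltW/muL2].
  have muX'E : mu (~` X' `|` (E1 `|` E2)) < (e / 4 + e / 4)%:E.
    apply: (le_lt_trans (probabilityU2 _ _ _)) => //; first exact: measurableC.
    rewrite probability_setC// X'1 subee// add0e.
    exact: measureU_lt.
  have -> : (e = (e / 4 + e / 4) + (e / 4 + e / 4))%R by lra.
  rewrite [in ltRHS]EFinD; apply: lte_leD => //.
  by rewrite ge0_fin_numE// (le_lt_trans muD12) ?ltry.
- move=> x y /not_orP[/not_orP[/contrapT X'x /not_orP[xE1 xE2]]].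
  move=> /not_orP[xD1 xD2] /not_orP[/not_orP[/contrapT X'y]].
  move=> /not_orP[yE1 yE2] /not_orP[yD1 yD2] Bxy Ax.
  apply: contrapT => nAy.
  have gx : g K x by apply: contrapT => gx; apply: xE1.
  have gy : g K' y by apply: contrapT => gy; apply: yE2.
  have [n /Bxy[Bn1 Bn2]] := FV (f x, f y) (conj gx.2 gy.2); apply.
  have [Bx|Bx] := pselect (B n x).
    left; split.
      have [//|] := pselect (g (L n).1 x); first by case.
      by move=> gLx; exfalso; apply: xD1; exists n.
    have [//|] := pselect (g (L n).1 y); first by case.
    by move=> gLy; exfalso; apply: yD1; exists n => //; split => //; exact: Bn1.
  right; split.
    have [//|] := pselect (g (L n).2 x); first by case.
    by move=> gLx; exfalso; apply: xD2; exists n.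
  have [//|] := pselect (g (L n).2 y); first by case.
  by move=> gLy; exfalso; apply: yD2; exists n => //; split => // /Bn2.
Qed.

(** * Admissible semimetrics *)

Lemma diam_lt (X : Type) (R : realType) (rho : X -> X -> R) (A : set X) (e : R) :
  diam rho A < e%:E -> forall x y, A x -> A y -> (rho x y < e)%R.
Proof.
rewrite /diam gt_max => /andP[_ Ae] x y Ax Ay; rewrite -lte_fin.
by apply: le_lt_trans Ae; apply: ereal_sup_ubound; exists (x, y).
Qed.

Lemma diam_le (X : Type) (R : realType) (rho : X -> X -> R) (A : set X) (e : R) :
  (0 <= e)%R -> (forall x y, A x -> A y -> (rho x y <= e)%R) ->
  diam rho A <= e%:E.
Proof.
move=> e0 Ae; rewrite /diam ge_max lee_fin e0/=.
by apply: ge_ereal_sup => _ [[x y] [/= Ax Ay] <-]; rewrite lee_fin Ae.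
Qed.

Lemma epsilon_entropy_decomposition d (X : measurableType d) (R : realType)
    (mu : probability X R) (rho : X -> X -> R) (e : R) :
  epsilon_entropy mu rho e < +oo -> exists k, has_decomposition mu rho e k.
Proof.
rewrite /epsilon_entropy; case: pselect => [h _|]; last by rewrite ltxx.
by case: h => k /asboolP; exists k.
Qed.

(** A point can fail to lie in small pieces at all late scales only if it is in every late
    exceptional set; the measures of these tend to zero, so such points form a null set. *)
Lemma admissible_pieces d (X : measurableType d) (R : realType)
    (mu : probability X R) (rho : X -> X -> R) : admissible mu rho ->
  exists (Xt : set X) (P : nat -> nat -> set X),
    [/\ measurable Xt, mu Xt = 1, forall j i, measurable (P j i),
      forall j i x y, P j i x -> P j i y -> (rho x y < j.+1%:R^-1)%R &
      forall x J, Xt x -> exists2 j, (J <= j)%N & exists i, P j i x].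
Proof.
move=> adm.
have j0 j : (0 < j.+1%:R^-1 :> R)%R by rewrite invr_gt0.
have /choice[kA kAP] : forall j, exists kA : nat * (nat -> set X),
  (0 < kA.1)%N /\ [/\ forall i, (i <= kA.1)%N -> measurable (kA.2 i),
      \bigcup_(i in [set i | (i <= kA.1)%N]) kA.2 i = setT,
      mu (kA.2 0%N) < (j.+1%:R^-1)%:E
    & forall i, (0 < i <= kA.1)%N -> diam rho (kA.2 i) < (j.+1%:R^-1)%:E].
  move=> j; have [k [k0 [A HA]]] := epsilon_entropy_decomposition (adm _ (j0 j)).
  by exists (k, A).
move: kAP => /all_and2[_ /all_and4[mA AT A0 Adiam]].
(* Index 0 is the exceptional set, which has no diameter bound; it and the indices past the last
   piece are replaced by the empty set. *)
pose P j i := if (0 < i <= (kA j).1)%N then (kA j).2 i else set0.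
pose N J := \bigcap_(j >= J) (kA j).2 0%N.
have mA0 j : measurable ((kA j).2 0%N) by exact: mA.
have mN J : measurable (N J).
  exact: bigcap_measurableType.
have N0 J : mu (N J) = 0.
  apply/eqP; rewrite eq_le measure_ge0 andbT; apply/lee_addgt0Pr => e e0.
  rewrite add0e; pose j := maxn J (Num.truncn e^-1).
  apply: (@le_trans _ _ (mu ((kA j).2 0%N))).
    rewrite le_measure ?inE//.
    by apply: bigcap_inf; rewrite /= leq_maxl.
  apply/ltW/(lt_trans (A0 _)); rewrite lte_fin invf_plt ?posrE ?ltr0n//.
  by rewrite (lt_le_trans (truncnS_gt _))// ler_nat ltnS leq_maxr.
exists (~` \bigcup_J N J), P; split.
- by apply: measurableC; exact: bigcupT_measurable.
- rewrite probability_setC; last exact: bigcupT_measurable.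
  suff -> : mu (\bigcup_J N J) = 0 by rewrite sube0.
  apply/negligibleP; first exact: bigcupT_measurable.
  apply: negligible_bigcup => J; exists (N J); split => //; exact: N0.
- by move=> j i; rewrite /P; case: ifPn => // /andP[_ /mA].
- by move=> j i x y; rewrite /P; case: ifPn => // /Adiam /diam_lt; apply.
- move=> x J xN; have [j Jj jx] : exists2 j, (J <= j)%N & ~ (kA j).2 0%N x.
    apply: contrapT => /forall2NP nj; apply: xN; exists J => // j /= Jj.
    by case: (nj j) => // /contrapT.
  exists j => //.
  have : (\bigcup_(i in [set i | (i <= (kA j).1)%N]) (kA j).2 i) x by rewrite AT.
  move=> [i /= ik ix]; exists i; rewrite /P ik andbT.
  by case: ifPn => //; rewrite -eqn0Ngt => /eqP i0; move: ix; rewrite i0.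
Qed.

(* On [Xt `*` Xt] the sublevel sets of [rho] are countable unions of rectangles
   of pieces, so that measurability holds without completing the product
   sigma-algebra. *)
Lemma admissible_measurable d (X : measurableType d) (R : realType)
    (mu : probability X R) (rho : X -> X -> R) :
  measurable_semimetric mu rho -> admissible mu rho ->
  exists (Xt : set X) (c : nat -> X) (q : nat -> R),
    [/\ measurable Xt /\ mu Xt = 1,
      measurable_fun (Xt `*` Xt) (fun p : X * X => rho p.1 p.2),
      forall n, Xt (c n) &
      forall x s, Xt x -> (0 < s)%R -> exists2 n, (rho (c n) x < q n)%R & (q n < s)%R].
Proof.
move=> [sym rho0 tri _] /admissible_pieces[Xt [P [mXt Xt1 mP Pdiam XtP]]].
have XtP' x (s : R) : Xt x -> (0 < s)%R ->
    exists j i, P j i x /\ (j.+1%:R^-1 < s)%R.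
  move=> Xtx s0; have [j sj [i Px]] := XtP x (Num.truncn s^-1) Xtx.
  exists j, i; split => //; rewrite invf_plt ?posrE ?ltr0n//.
  by rewrite (lt_le_trans (truncnS_gt _))// ler_nat ltnS.
have [x0 Xtx0] : Xt !=set0.
  apply/set0P; apply/eqP => Xt0; move: Xt1; rewrite Xt0 measure0 => /eqP.
  by rewrite lt_eqF.
(* One center is chosen in each piece that meets [Xt], with the diameter bound of that piece as
   radius; [x0] fills the remaining indices. *)
have /choice[c cP] : forall n : nat, exists x, Xt x /\
    forall j i, unpickle n = Some (j : nat, i : nat) -> P j i `&` Xt !=set0 -> P j i x.
  move=> n; case: (unpickle n) => [[j i]|]; last by exists x0.
  have [[x [Px Xtx]]|nP] := pselect (P j i `&` Xt !=set0).
    by exists x; split => // _ _ [<- <-].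
  by exists x0; split => // _ _ [<- <-].
exists Xt, c, (fun n => if (unpickle n : option (nat * nat)) is Some (j, _) then j.+1%:R^-1 else 0 : R)%R.
split => //.
- move=> mXX; apply: (measurability _ (RGenInftyO.measurableE R)) => //.
  move=> _ [_ [a ->] <-].
  (* A rectangle of pieces is kept only if [rho < a] on all of it. Pieces of diameter below half the
     gap [a - rho x y] yield a kept rectangle around any point of the sublevel set. *)
  pose F (u : (nat * nat) * (nat * nat)) : set (X * X) :=
    let U := (Xt `*` Xt) `&` (P u.1.1 u.1.2 `*` P u.2.1 u.2.2) in
    if `[< forall p, U p -> (rho p.1 p.2 < a)%R >] then U else set0.
  rewrite (_ : _ `&` _ = \bigcup_u F u); last first.
    apply/seteqP; split => [[x y] /= [[Xtx Xty]]|[x y] [u _]]; last first.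
      rewrite /F; case: asboolP => // ua Uxy; split; first by case: Uxy.
      by rewrite /= in_itv/=; exact: (ua _ Uxy).
    rewrite in_itv/= => xya.
    have s0 : (0 < (a - rho x y) / 2)%R by rewrite divr_gt0// subr_gt0.
    have [j [i [Px js]]] := XtP' _ _ Xtx s0.
    have [l [k [Py ls]]] := XtP' _ _ Xty s0.
    exists ((j, i), (l, k)) => //; rewrite /F/=; case: asboolP => //; case.
    move=> [x' y'] /= [_ [Px' Py']].
    have t1 := tri x' x y'; have t2 := tri x y y'.
    have := lt_trans (Pdiam _ _ _ _ Px' Px) js.
    have := lt_trans (Pdiam _ _ _ _ Py Py') ls.
    by lra.
  apply: countable_bigcupT_measurable; first exact: countableP.
  move=> u; rewrite /F; case: asboolP => // _.
  by apply: measurableI => //; exact: measurableX.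
- by move=> n; case: (cP n).
- move=> x s Xtx s0; have [j [i [Px js]]] := XtP' _ _ Xtx s0.
  exists (pickle (j, i)); rewrite pickleK//.
  have [_ cji] := cP (pickle (j, i)).
  apply: (Pdiam j i) => //; apply: cji; rewrite ?pickleK//.
  by exists x.
Qed.

(** Measurability is not assumed: the integral of a non-negative function is a supremum over the
    simple functions below it. This allows a comparison with [rho], which is measurable only for the
    completed product. *)
Lemma le_ge0_integral d (X : measurableType d) (R : realType)
    (mu : {measure set X -> \bar R}) (f g : X -> \bar R) :
  (forall x, 0 <= f x) -> (forall x, f x <= g x) ->
  \int[mu]_x f x <= \int[mu]_x g x.
Proof.
move=> f0 fg; rewrite !ge0_integralTE//; last first.
  by move=> x; exact: le_trans (fg x).
apply: le_ereal_sup => _ [h hf <-]; exists h => // x.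
exact: le_trans (fg x).
Qed.

(** Tonelli gives a base point [x0] for which the distance to [x0] is integrable; this distance is
    [r], and the bound is the triangle inequality through [x0]. *)
Lemma integrable_semimetric_le d (X : measurableType d) (R : realType)
    (mu : probability X R) (rho : X -> X -> R) :
  measurable_semimetric mu rho -> admissible mu rho -> finite_integral mu rho ->
  exists (X1 : set X) (r : X -> R), [/\ measurable X1 /\ mu X1 = 1,
    measurable_fun setT r, forall x, (0 <= r x)%R,
    \int[mu]_x (r x)%:E < +oo &
    forall x y, X1 x -> X1 y -> (rho x y <= r x + r y)%R].
Proof.
move=> hrho adm fin.
have [Xt [_ [_ [[mXt Xt1] mrho _ _]]]] := admissible_measurable hrho adm.
move: hrho => [sym rho0 tri _].
(* Extension by zero off [Xt] makes the function measurable for the product sigma-algebra itself. *)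
pose sigma : X * X -> R := (fun p => rho p.1 p.2) \_ (Xt `*` Xt).
have sigma0 p : (0 <= sigma p)%R by rewrite /sigma /patch; case: ifP.
have sigmaE x y : Xt x -> Xt y -> sigma (x, y) = rho x y.
  by move=> Xtx Xty; rewrite /sigma patchT// inE.
have msigma : measurable_fun setT sigma.
  by apply/(measurable_restrictT _ _).1 => //; exact: measurableX.
have mEsigma : measurable_fun setT (EFin \o sigma) by exact/measurable_EFinP.
have sigma_fin : \int[mu \x mu]_p (sigma p)%:E < +oo.
  apply: le_lt_trans fin; apply: le_ge0_integral => p; rewrite lee_fin//.
  by rewrite /sigma /patch; case: ifP.
pose F x := \int[mu]_y (sigma (x, y))%:E.
have F0 x : 0 <= F x by apply: integral_ge0 => y _; rewrite lee_fin.
have Fint : mu.-integrable setT F.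
  apply/integrableP; split.
    exact: (@measurable_fun_fubini_tonelli_F _ _ _ _ _ mu (EFin \o sigma)).
  under eq_integral do rewrite gee0_abs//.
  by rewrite -(@fubini_tonelli1 _ _ _ _ _ mu mu (EFin \o sigma)).
have [x0 Xtx0 Fx0] : exists2 x0, Xt x0 & F x0 \is a fin_num.
  have [N [mN N0 FN]] := integrable_ae measurableT Fint.
  apply: contrapT => /forall2NP nF.
  have : mu Xt <= mu N.
    rewrite le_measure ?inE// => x Xtx; apply: FN => /= /(_ I) Fx.
    by case: (nF x).
  by rewrite Xt1 N0 leNgt lte_fin ltr01.
exists Xt, (fun y => sigma (x0, y)); split => //.
- exact: (@measurable_fun_pair2 _ _ _ _ _ _ sigma).
- by move: Fx0; rewrite ge0_fin_numE.
- by move=> x y Xtx Xty; rewrite !sigmaE// (sym x0 x).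
Qed.

(** * Uniform control by finitely many iterates *)

Definition orbit_sum (X : Type) (R : realType) (T : X -> X)
    (rho : X -> X -> R) (m : nat) (x y : X) : R :=
  (\sum_(k < m) rho (iter k T x) (iter k T y))%R.

Lemma orbit_sum_ge0 (X : Type) (R : realType) (T : X -> X)
    (rho : X -> X -> R) m x y :
  (forall x y, (0 <= rho x y)%R) -> (0 <= orbit_sum T rho m x y)%R.
Proof. by move=> rho0; apply: sumr_ge0. Qed.

Lemma orbit_sumC (X : Type) (R : realType) (T : X -> X)
    (rho : X -> X -> R) m x y : (forall x y, rho x y = rho y x) ->
  orbit_sum T rho m x y = orbit_sum T rho m y x.
Proof. by move=> rhoC; apply: eq_bigr => k _; exact: rhoC. Qed.

Lemma le_orbit_sum (X : Type) (R : realType) (T : X -> X)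
    (rho : X -> X -> R) m p x y :
  (forall x y, (0 <= rho x y)%R) -> (m <= p)%N ->
  (orbit_sum T rho m x y <= orbit_sum T rho p x y)%R.
Proof.
move=> rho0 /subnKC <-; rewrite /orbit_sum big_split_ord/= lerDl.
exact: sumr_ge0.
Qed.

Lemma orbit_sum_nth (X : Type) (R : realType) (T : X -> X)
    (rho : X -> X -> R) m k x y :
  (forall x y, (0 <= rho x y)%R) -> (k < m)%N ->
  (rho (iter k T x) (iter k T y) <= orbit_sum T rho m x y)%R.
Proof.
move=> rho0 km; rewrite /orbit_sum (bigD1 (Ordinal km))//= lerDl.
exact: sumr_ge0.
Qed.

Definition birkhoff_sum (X : Type) (R : realType) (T : X -> X) (g : X -> R)
    (n : nat) (x : X) : R := (\sum_(j < n) g (iter j T x))%R.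

Lemma birkhoff_sum_ge0 (X : Type) (R : realType) (T : X -> X) (g : X -> R) n x :
  (forall x, (0 <= g x)%R) -> (0 <= birkhoff_sum T g n x)%R.
Proof. by move=> g0; apply: sumr_ge0. Qed.

Definition measure_preserving d (X : measurableType d) (R : realType)
    (mu : probability X R) (T : X -> X) : Prop :=
  measurable_fun setT T /\
  forall A : set X, measurable A -> mu (T @^-1` A) = mu A.

Lemma measurable_preimage d (X : measurableType d) (T : X -> X) (A : set X) :
  measurable_fun setT T -> measurable A -> measurable (T @^-1` A).
Proof. by move=> mT mA; rewrite -[X in measurable X]setTI; exact: mT. Qed.

Lemma measure_preserving_iter d (X : measurableType d) (R : realType)
    (mu : probability X R) (T : X -> X) k :
  measure_preserving mu T -> measure_preserving mu (iter k T).
Proof.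
move=> [mT muT]; elim: k => [|k [mTk muTk]]; first by split => //; exact: measurable_id.
split; first exact: (measurableT_comp mT mTk).
move=> A mA; rewrite -(muT _ mA) -(muTk (T @^-1` A))//.
exact: measurable_preimage.
Qed.

Section controlled.
Context d (X : measurableType d) (R : realType) (mu : probability X R).
Variables (T : X -> X) (omega : X -> X -> R).
Hypothesis hT : measure_preserving mu T.
Hypothesis omega_semimetric : measurable_semimetric mu omega.

(** Uniform continuity in the manner of Lusin: smallness of [omega] along a finite orbit segment
    forces [P], up to an exceptional set of arbitrarily small measure. *)
Definition controlled (P : X -> X -> Prop) : Prop :=
  forall e : R, (0 < e)%R -> exists (delta : R) (m : nat) (E : set X),
    [/\ (0 < delta)%R, measurable E, mu E < e%:E &
      forall x y, ~ E x -> ~ E y -> (orbit_sum T omega m x y < delta)%R -> P x y].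

Let omega0 x y : (0 <= omega x y)%R. Proof. by case: omega_semimetric. Qed.
Let omegaC x y : omega x y = omega y x. Proof. by case: omega_semimetric. Qed.

Lemma controlled_forall (P : nat -> X -> X -> Prop) :
  (forall n, controlled (P n)) ->
  forall N, controlled (fun x y => forall n, (n < N)%N -> P n x y).
Proof.
move=> cP; elim=> [|N IH] e e0.
  exists 1%R, 0%N, set0; by split => //; rewrite measure0 lte_fin.
have e20 : (0 < e / 2)%R by rewrite divr_gt0.
have [a [m [E [a0 mE Ee HE]]]] := IH _ e20.
have [b [p [F [b0 mF Fe HF]]]] := cP N _ e20.
exists (Num.min a b), (maxn m p), (E `|` F); split.
- by rewrite lt_min a0.
- exact: measurableU.
- by rewrite [in ltRHS](splitr e); exact: measureU_lt.
move=> x y /not_orP[Ex Fx] /not_orP[Ey Fy]; rewrite lt_min => /andP[xa xb] n.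
rewrite ltnS leq_eqVlt => /orP[/eqP ->|nN].
  by apply: HF => //; apply: le_lt_trans xb; rewrite le_orbit_sum// leq_maxr.
by apply: HE => //; apply: le_lt_trans xa; rewrite le_orbit_sum// leq_maxl.
Qed.

Lemma controlled_sym (P : X -> X -> Prop) :
  controlled P -> controlled (fun x y => P x y /\ P y x).
Proof.
move=> cP e /cP[a [m [E [a0 mE Ee HE]]]]; exists a, m, E; split => // x y Ex Ey xy.
by split; apply: HE => //; rewrite orbit_sumC.
Qed.

Lemma controlled_iter (P : X -> X -> Prop) k :
  (forall e : R, (0 < e)%R -> exists (delta : R) (E : set X),
    [/\ (0 < delta)%R, measurable E, mu E < e%:E &
      forall x y, ~ E x -> ~ E y -> (omega x y < delta)%R -> P x y]) ->
  controlled (fun x y => P (iter k T x) (iter k T y)).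
Proof.
have [mTk muTk] := measure_preserving_iter k hT.
move=> cP e /cP[a [E [a0 mE Ee HE]]]; exists a, k.+1, (iter k T @^-1` E).
split => //; first exact: measurable_preimage.
  by rewrite muTk.
move=> x y Ex Ey xy; apply: HE => //; apply: le_lt_trans xy.
exact: orbit_sum_nth.
Qed.

(** A move shorter than the width of a shell just inside the sphere of radius [q] cannot leave the
    ball unless it starts in the shell. Shrinking shells have empty intersection, hence small
    measure. *)
Lemma ball_stable (Xt : set X) (c : X) (q : R) :
  measurable Xt -> mu Xt = 1 -> measurable_fun Xt (omega c) ->
  forall e : R, (0 < e)%R -> exists (delta : R) (E : set X),
    [/\ (0 < delta)%R, measurable E, mu E < e%:E &
      forall x y, ~ E x -> ~ E y -> (omega x y < delta)%R ->
        (Xt `&` [set z | (omega c z < q)%R]) x ->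
        (Xt `&` [set z | (omega c z < q)%R]) y].
Proof.
move=> mXt Xt1 mc e e0.
pose D (n : nat) := Xt `&` omega c @^-1` `[(q - n.+1%:R^-1)%R, q[.
have mD n : measurable (D n) by exact: mc.
have [||n Dn] := @measure_nonincreasing_lt _ _ _ mu D e e0 mD.
- apply/nonincreasing_seqP => n; apply/subsetPset => x [Xtx] /=.
  rewrite !in_itv/= => /andP[h xq]; split => //=; rewrite in_itv/= xq andbT.
  by apply: le_trans h; rewrite lerD2l lerN2 lef_pV2 ?posrE// ler_nat.
- apply/seteqP; split => // x Dx.
  have [_ /=] := Dx 0%N I; rewrite in_itv/= => /andP[_ xq].
  have qx : (0 < q - omega c x)%R by rewrite subr_gt0.
  have [_ /=] := Dx (Num.truncn (q - omega c x)^-1) I.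
  rewrite in_itv/= leNgt xq andbT => /negP; apply.
  rewrite ltrBrDl -ltrBrDr invf_plt ?posrE ?ltr0n//.
  exact: truncnS_gt.
exists n.+1%:R^-1%R, (~` Xt `|` D n); split.
- by rewrite invr_gt0.
- by apply: measurableU => //; exact: measurableC.
- apply: (le_lt_trans (probabilityU2 _ _ _)) => //; first exact: measurableC.
  by rewrite probability_setC// Xt1 subee// add0e.
move=> x y /not_orP[_ Dx] /not_orP[/contrapT Xty _] xy [Xtx /= xq]; split => //=.
have xqn : (omega c x < q - n.+1%:R^-1)%R.
  rewrite ltNge; apply/negP => h; apply: Dx; split => //=.
  by rewrite in_itv/= h.
have [_ _ tri _] := omega_semimetric.
by apply: (le_lt_trans (tri c x y)); rewrite -[ltRHS](subrK n.+1%:R^-1%R) ltrD.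
Qed.

Hypothesis omega_admissible : admissible mu omega.
Hypothesis omega_generating : generating mu T omega.
Hypothesis hmu : standard_probability mu.

Lemma controlled_set (A : set X) :
  measurable A -> controlled (fun x y => A x -> A y).
Proof.
move=> mA.
have [Xt [c [q [[mXt Xt1] mom Xtc cq]]]] :=
  admissible_measurable omega_semimetric omega_admissible.
have mc n : measurable_fun Xt (omega (c n)).
  apply: (measurable_comp (F := Xt `*` Xt)
    (f := fun p : X * X => omega p.1 p.2) (g := pair (c n))) => //.
  - exact: measurableX.
  - by move=> _ [y Xty <-]; split => //=; exact: Xtc.
  - exact/measurable_funTS/pair1_measurable.
pose b n := Xt `&` [set z | (omega (c n) z < q n)%R].
have mb n : measurable (b n).
  rewrite (_ : b n = Xt `&` omega (c n) @^-1` `]-oo, q n[); first exact: mc.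
  by apply/seteqP; split => x [Xtx] /= xq; split => //=; move: xq; rewrite in_itv.
pose B (i : nat) := if (unpickle i : option (nat * nat)) is Some (n, k)
  then iter k T @^-1` b n else set0.
have mTk k := measure_preserving_iter k hT.
have mB i : measurable (B i).
  rewrite /B; case: (unpickle i) => [[n k]|//].
  by apply: measurable_preimage => //; case: (mTk k).
have cB i : controlled (fun x y => B i x <-> B i y).
  have : controlled (fun x y => B i x -> B i y).
    rewrite /B; case: (unpickle i) => [[n k]|]; last first.
      by move=> e e0; exists 1%R, 0%N, set0; split => //; rewrite measure0 lte_fin.
    apply: (@controlled_iter (fun x y => b n x -> b n y)).
    exact: ball_stable.
  by move/controlled_sym.
have [X' [mX' X'1 gen]] := omega_generating.
pose X1 := X' `&` \bigcap_k (iter k T @^-1` Xt).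
have mTXt k : measurable (iter k T @^-1` Xt).
  by apply: measurable_preimage => //; case: (mTk k).
have mX1 : measurable X1 by apply: measurableI => //; exact: bigcapT_measurable.
have X11 : mu X1 = 1.
  apply: full_setI => //; first exact: bigcapT_measurable.
  by apply: full_bigcap => // k; case: (mTk k) => _ ->.
move=> e e0; have e20 : (0 < e / 2)%R by rewrite divr_gt0.
(* Distinct points have a positive [omega]-distance at some time [k]. A ball of radius below half of
   it that contains one of the two iterates misses the other. *)
have [|M [E [mE Ee HE]]] := standard_separating hmu mX1 X11 mB _ mA e20.
  move=> x y [X'x Xtx] [X'y Xty] Bxy; apply: contrapT => /(gen _ _ X'x X'y)[n n0].
  rewrite /averaged pmulr_rgt0 ?invr_gt0 ?ltr0n// => sum0.
  have [k xyk] : exists k, (0 < omega (iter k T x) (iter k T y))%R.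
    apply: contrapT => /forallNP omk; move: sum0; rewrite ltNge => /negP; apply.
    by apply: sumr_le0 => k _; rewrite leNgt; apply/negP/omk.
  have [|m cm qm] := cq _ (omega (iter k T x) (iter k T y) / 2)%R (Xtx k I).
    by rewrite divr_gt0.
  have [+ _] := Bxy (pickle (m, k)); rewrite /B !pickleK/= /b /=.
  move=> /(_ (conj (Xtx k I) cm)) [_] /= cym.
  have [_ _ tri _] := omega_semimetric.
  have := tri (iter k T x) (c m) (iter k T y).
  by rewrite (omegaC _ (c m)); lra.
have [a [m [F [a0 mF Fe HF]]]] := controlled_forall cB M e20.
exists a, m, (E `|` F); split => //.
- exact: measurableU.
- by rewrite [in ltRHS](splitr e); exact: measureU_lt.
- by move=> x y /not_orP[Ex Fx] /not_orP[Ey Fy] /(HF x y Fx Fy); exact: HE.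
Qed.

(** Membership in each of the finitely many pieces is controlled, so [y] lies in the piece of [x],
    whose diameter is below [e]. *)
Lemma controlled_semimetric (rho : X -> X -> R) (e : R) :
  admissible mu rho -> (0 < e)%R -> controlled (fun x y => (rho x y < e)%R).
Proof.
move=> adm e0 s s0; pose t : R := Num.min e (s / 2)%R.
have t0 : (0 < t)%R by rewrite lt_min e0 divr_gt0.
have [k [k0 [A [mA AT A0 Ad]]]] := epsilon_entropy_decomposition (adm _ t0).
pose B i := if (i <= k)%N then A i else set0.
have cB i : controlled (fun x y => B i x -> B i y).
  by apply: controlled_set; rewrite /B; case: ifPn => // /mA.
have s20 : (0 < s / 2)%R by rewrite divr_gt0.
have [a [m [F [a0 mF Fe HF]]]] := controlled_forall cB k.+1 s20.
exists a, m, (A 0%N `|` F); split => //.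
- by apply: measurableU => //; exact: mA.
- rewrite [in ltRHS](splitr s); apply: measureU_lt => //; first exact: mA.
  by apply: (lt_le_trans A0); rewrite lee_fin ge_min lexx orbT.
move=> x y /not_orP[Ax Fx] /not_orP[Ay Fy] xy.
have : (\bigcup_(i in [set i | (i <= k)%N]) A i) x by rewrite AT.
move=> [i /= ik ix]; have := HF _ _ Fx Fy xy i; rewrite ltnS /B ik => /(_ erefl ix) iy.
have i0 : (0 < i <= k)%N.
  by rewrite ik andbT; case: i ix {iy ik} => //.
have := diam_lt (Ad _ i0) ix iy; rewrite lt_min => /andP[]//.
Qed.

End controlled.

(** * Integrals along orbits *)

(** The bad set [E] is moved into the exceptional piece, so the number of pieces does not change.
    The bound [c] is strictly below [eta] because a supremum preserves only weak inequalities. *)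
Lemma decomposition_transfer d (X : measurableType d) (R : realType)
    (mu : probability X R) (sigma rho : X -> X -> R) (E : set X)
    (delta s c eta : R) k :
  measurable E -> mu E < s%:E -> (delta + s <= eta)%R -> (0 <= c < eta)%R ->
  (forall x y, ~ E x -> ~ E y -> (sigma x y < delta)%R -> (rho x y <= c)%R) ->
  has_decomposition mu sigma delta k -> has_decomposition mu rho eta k.
Proof.
move=> mE Es dse /andP[c0 ce] Hc [k0 [A [mA AT A0 Ad]]]; split => //.
exists (fun i => if i is 0%N then A 0%N `|` E else A i `\` E); split.
- move=> [|i] ik; first by apply: measurableU => //; exact: mA.
  by apply: measurableD => //; exact: mA.
- apply/seteqP; split => // x _.
  have [Ex|Ex] := pselect (E x); first by exists 0%N => //; right.
  have : (\bigcup_(i in [set i | (i <= k)%N]) A i) x by rewrite AT.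
  by move=> [[|i] /= ik Ax]; [exists 0%N => //; left|exists i.+1].
- apply: (@lt_le_trans _ _ (delta + s)%:E); last by rewrite lee_fin.
  by apply: measureU_lt => //; exact: mA.
- move=> [//|i] ik; apply: (@le_lt_trans _ _ c%:E); last by rewrite lte_fin.
  apply: diam_le => // x y [Ax Ex] [Ay Ey]; apply: Hc => //.
  exact: (diam_lt (Ad _ ik)).
Qed.

Section integral_real.
Context d (X : measurableType d) (R : realType) (mu : probability X R).
Implicit Types g h : X -> R.

Lemma ge0_integralD_EFin g h : measurable_fun setT g -> measurable_fun setT h ->
  (forall x, (0 <= g x)%R) -> (forall x, (0 <= h x)%R) ->
  \int[mu]_x (g x + h x)%:E = \int[mu]_x (g x)%:E + \int[mu]_x (h x)%:E.
Proof.
move=> mg mh g0 h0; rewrite -ge0_integralD//; try exact/measurable_EFinP;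
  by move=> x _; rewrite lee_fin.
Qed.

Lemma ge0_integralZ_EFin g k : measurable_fun setT g ->
  (forall x, (0 <= g x)%R) -> (0 <= k)%R ->
  \int[mu]_x (k * g x)%:E = k%:E * \int[mu]_x (g x)%:E.
Proof.
move=> mg g0 k0; rewrite -ge0_integralZl_EFin//; first by move=> x _; rewrite lee_fin.
exact/measurable_EFinP.
Qed.

Lemma ge0_integral_iter (T : X -> X) g k : measure_preserving mu T ->
  measurable_fun setT g -> (forall x, (0 <= g x)%R) ->
  \int[mu]_x (g (iter k T x))%:E = \int[mu]_x (g x)%:E.
Proof.
move=> hT mg g0; have [mTk muTk] := measure_preserving_iter k hT.
have := @ge0_integral_pushforward _ _ _ _ _ _ mTk mu setT (EFin \o g) measurableT.
rewrite preimage_setT => <- //.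
- by apply: eq_measure_integral => A mA _; rewrite -[RHS]muTk.
- exact/measurable_EFinP.
- by move=> x _; rewrite lee_fin.
Qed.

Lemma markov_lt g (c s : R) : measurable_fun setT g ->
  (forall x, (0 <= g x)%R) -> (0 < c)%R ->
  \int[mu]_x (g x)%:E <= (c * s)%:E -> mu [set x | (c <= g x)%R] <= s%:E.
Proof.
move=> mg g0 c0 gcs.
have mEg : measurable_fun setT (EFin \o g) by exact/measurable_EFinP.
have := le_integral_abse mu measurableT mEg c0.
under eq_integral do rewrite gee0_abs ?lee_fin//.
move=> /le_trans/(_ gcs); rewrite setTI EFinM lee_pmul2l//.
congr (mu _ <= _); apply/seteqP; split => x /=; rewrite ger0_norm ?lee_fin//.
Qed.

Lemma integral_tail_lt g (e : R) : measurable_fun setT g ->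
  (forall x, (0 <= g x)%R) -> \int[mu]_x (g x)%:E < +oo -> (0 < e)%R ->
  exists n, \int[mu]_x (Num.max (g x - n%:R) 0)%:E < e%:E.
Proof.
move=> mg g0 gfin e0; pose f n x := (Num.max (g x - n%:R) 0)%:E.
have mf n : measurable_fun setT (f n).
  apply/measurable_EFinP; apply: measurable_maxr => //.
  exact: measurable_funB.
have f0 n x : 0 <= f n x by rewrite lee_fin le_max lexx orbT.
have [||||_ _] := @dominated_convergence _ _ _ mu _ measurableT f (cst 0)
    (EFin \o g) mf.
- exact: measurable_cst.
- apply: aeW => x _; apply: cvg_near_cst; exists (Num.truncn (g x)).+1 => // n /= ng.
  rewrite /f max_r// subr_le0 ltW// (lt_le_trans (truncnS_gt _))// ler_nat//.
- apply/integrableP; split; first exact/measurable_EFinP.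
  by under eq_integral do rewrite gee0_abs ?lee_fin//.
- apply: aeW => x n _; rewrite gee0_abs// lee_fin ge_max g0 andbT.
  by rewrite lerBlDr lerDl.
rewrite integral0 => fcvg.
have : \forall n \near \oo, \int[mu]_x f n x < e%:E.
  apply: (fcvg [set y | y < e%:E]); apply: open_nbhs_nbhs; split.
    exact: open_ereal_lt_ereal.
  by rewrite /= lte_fin.
by case=> N _ /(_ N (leqnn N)); exists N.
Qed.

Lemma measurable_birkhoff_sum T g n : measure_preserving mu T ->
  measurable_fun setT g -> measurable_fun setT (birkhoff_sum T g n).
Proof.
move=> hT mg; apply: measurable_sum => j.
by apply: measurableT_comp => //; case: (measure_preserving_iter j hT).
Qed.

Lemma integral_birkhoff_sum T g n : measure_preserving mu T ->
  measurable_fun setT g -> (forall x, (0 <= g x)%R) ->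
  \int[mu]_x (birkhoff_sum T g n x)%:E = n%:R%:E * \int[mu]_x (g x)%:E.
Proof.
move=> hT mg g0; elim: n => [|n IH].
  rewrite mul0e; apply: integral0_eq => x _.
  by rewrite /birkhoff_sum big_ord0.
under eq_integral do rewrite /birkhoff_sum big_ord_recr/= -/(birkhoff_sum T g n _).
rewrite ge0_integralD_EFin//; last 3 first.
- exact: measurable_birkhoff_sum.
- by apply: measurableT_comp => //; case: (measure_preserving_iter n hT).
- by move=> x; exact: birkhoff_sum_ge0.
rewrite IH ge0_integral_iter// -natr1 EFinD ge0_muleDl ?mul1e// lee_fin//.
Qed.

End integral_real.

(** * Comparison for large times *)

Lemma sum_shift_le (R : realType) (a : nat -> R) k m n :
  (forall i, (0 <= a i)%R) -> (k <= m)%N ->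
  (\sum_(j < n) a (k + j)%N <= \sum_(j < n + m) a j)%R.
Proof.
move=> a0 km; rewrite -(subnKC km) addnA big_split_ord/= (addnC n k) big_split_ord/=.
rewrite -addrA addrCA lerDl addr_ge0//; exact: sumr_ge0.
Qed.

(** Each time below [n + m] is counted at most [m] times in the double sum; the times from [n] on
    are bounded through [r]. *)
Lemma orbit_sum_orbit_sum_le (X : Type) (R : realType) (T : X -> X)
    (omega : X -> X -> R) (r : X -> R) (m n : nat) (x y : X) :
  (forall x y, (0 <= omega x y)%R) ->
  (forall k, (omega (iter k T x) (iter k T y) <=
    r (iter k T x) + r (iter k T y))%R) ->
  (\sum_(j < n) orbit_sum T omega m (iter j T x) (iter j T y) <=
   m%:R * (orbit_sum T omega n x y + (birkhoff_sum T r m (iter n T x) +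
     birkhoff_sum T r m (iter n T y))))%R.
Proof.
move=> omega0 omr; rewrite exchange_big/=.
pose a i := omega (iter i T x) (iter i T y).
rewrite [leRHS](_ : _ = \sum_(k < m) (orbit_sum T omega n x y +
    (birkhoff_sum T r m (iter n T x) + birkhoff_sum T r m (iter n T y))))%R; last first.
  by rewrite sumr_const card_ord mulr_natl.
apply: ler_sum => k _.
apply: (@le_trans _ _ (\sum_(j < n) a (k + j)%N)%R).
  by apply: ler_sum => j _; rewrite /a !iterD.
apply: (le_trans (sum_shift_le (a := a) n _ (ltnW (ltn_ord k)))).
  by move=> i; exact: omega0.
rewrite big_split_ord/= lerD2l -big_split/=; apply: ler_sum => j _.
by rewrite -!iterD (addnC j) omr.
Qed.

Section comparison.
Context d (X : measurableType d) (R : realType) (mu : probability X R).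
Variables (T : X -> X) (rho omega : X -> X -> R).
Hypothesis hmu : standard_probability mu.
Hypothesis hT : measure_preserving mu T.
Hypothesis rho_semimetric : measurable_semimetric mu rho.
Hypothesis rho_admissible : admissible mu rho.
Hypothesis rho_integral : finite_integral mu rho.
Hypothesis omega_semimetric : measurable_semimetric mu omega.
Hypothesis omega_admissible : admissible mu omega.
Hypothesis omega_generating : generating mu T omega.
Hypothesis omega_integral : finite_integral mu omega.

Let omega0 x y : (0 <= omega x y)%R. Proof. by case: omega_semimetric. Qed.
Let rho0 x y : (0 <= rho x y)%R. Proof. by case: rho_semimetric. Qed.

Lemma semimetric_domination (a b : R) : (0 < a)%R -> (0 < b)%R ->
  exists (X1 : set X) (L : R) (m : nat) (g : X -> R),
  [/\ measurable X1 /\ mu X1 = 1,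
    measurable_fun setT g /\ (forall x, (0 <= g x)%R),
    \int[mu]_x (g x)%:E <= b%:E, (0 <= L)%R &
    forall x y, X1 x -> X1 y ->
      (rho x y <= a + L * orbit_sum T omega m x y + (g x + g y))%R].
Proof.
move=> a0 b0.
have [X1 [r [[mX1 X11] mr r0 rfin rhor]]] :=
  integrable_semimetric_le rho_semimetric rho_admissible rho_integral.
have b20 : (0 < b / 2)%R by rewrite divr_gt0.
have [n tail] := integral_tail_lt mr r0 rfin b20.
(* The tail of [r] uses half of the budget [b]. This bound on the measure of [E] keeps the indicator
   term of [g] within the other half; [n.+1] avoids division by zero. *)
have s0 : (0 < b / 2 / (2 * n.+1%:R))%R by rewrite !divr_gt0// mulr_gt0.
have [delta [m [E [d0 mE Es HE]]]] := controlled_semimetric hT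
  omega_semimetric omega_admissible omega_generating hmu rho_admissible a0 s0.
pose g x := (Num.max (r x - n%:R) 0 + 2 * n.+1%:R * \1_E x)%R.
have g10 x : (0 <= Num.max (r x - n%:R) 0)%R by rewrite le_max lexx orbT.
have mg1 : measurable_fun setT (fun x => Num.max (r x - n%:R) 0 : R)%R.
  by apply: measurable_maxr => //; exact: measurable_funB.
have n0 : (0 <= 2 * n.+1%:R :> R)%R by [].
have m1 : measurable_fun setT (\1_E : X -> R) by exact: measurable_indic.
have mg2 : measurable_fun setT (fun x => 2 * n.+1%:R * \1_E x : R)%R.
  exact: measurable_funM.
have g20 x : (0 <= 2 * n.+1%:R * \1_E x :> R)%R by rewrite mulr_ge0.
exists X1, (2 * n%:R / delta)%R, m, g; split => //.
- split; first exact: measurable_funD.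
  by move=> x; rewrite addr_ge0.
- rewrite ge0_integralD_EFin// ge0_integralZ_EFin// integral_indic// setIT.
  rewrite [leRHS](_ : _ = (b / 2 + b / 2)%:E); last by rewrite -splitr.
  rewrite EFinD; apply: leeD; first exact: ltW.
  apply: (@le_trans _ _ ((2 * n.+1%:R)%:E * (b / 2 / (2 * n.+1%:R))%:E)).
    by rewrite lee_pmul2l// ?lte_fin ?mulr_gt0//; exact: ltW.
  by rewrite -EFinM lee_fin mulrC divfK// mulf_neq0.
- by rewrite divr_ge0// ltW.
move=> x y X1x X1y.
have rg z : (r z <= n%:R + Num.max (r z - n%:R) 0)%R.
  by rewrite -lerBlDl le_max lexx.
have os0 : (0 <= orbit_sum T omega m x y)%R by exact: orbit_sum_ge0.
have L0 : (0 <= 2 * n%:R / delta * orbit_sum T omega m x y)%R.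
  by rewrite mulr_ge0// divr_ge0// ltW.
have nn : (0 <= n%:R :> R)%R by [].
have := rhor _ _ X1x X1y; have := rg x; have := rg y.
have gx := g20 x; have gy := g20 y.
have g1x := g10 x; have g1y := g10 y.
move: gx gy; rewrite /g -natr1.
(* If either point is in [E], the indicator term covers the truncated parts of [r x + r y], at most
   [2 * n]. Otherwise [rho x y < a] when the orbit sum is below [delta], and the choice of [L] makes
   the middle term at least [2 * n] when it is not. *)
have [Ex|Ex] := pselect (E x).
  by rewrite [\1_E x]indicE mem_set// mulr1; lra.
have [Ey|Ey] := pselect (E y).
  by rewrite [\1_E y]indicE mem_set// mulr1; lra.
have [xy|xy] := ltP (orbit_sum T omega m x y) delta.
  by have := HE x y Ex Ey xy; lra.
have : (2 * n%:R <= 2 * n%:R / delta * orbit_sum T omega m x y)%R.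
  by rewrite -mulrA ler_peMr// mulrC ler_pdivlMr// mul1r.
lra.
Qed.

(* The [omega]-distances at the times [n + k], [k < m], are not seen by
   [averaged T n omega]; their integrable bound [r] makes their contribution to
   [F] of order [1 / n]. *)
Lemma averaged_decomposition_large (eta : R) : (0 < eta)%R ->
  exists (delta : R) (n0 : nat), (0 < delta)%R /\
    forall n k, (n0 <= n)%N -> (0 < n)%N ->
      has_decomposition mu (averaged T n omega) delta k ->
      has_decomposition mu (averaged T n rho) eta k.
Proof.
move=> eta0.
(* The error [F] will have integral at most [2 * b], which is [eta / 8] times [eta / 4]. Markov at
   level [eta / 8] then leaves a bad set of measure at most [eta / 4]. *)
pose a : R := (eta / 8)%R; pose b : R := (eta ^+ 2 / 64)%R.
have a0 : (0 < a)%R by rewrite divr_gt0.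
have b0 : (0 < b)%R by rewrite divr_gt0// exprn_gt0.
have [X1 [L [m [g [[mX1 X11] [mg g0] gb L0 Hrho]]]]] :=
  semimetric_domination a0 b0.
have [X2 [r [[mX2 X21] mr r0 rfin omr]]] :=
  integrable_semimetric_le omega_semimetric omega_admissible omega_integral.
have rJ : \int[mu]_x (r x)%:E = (fine (\int[mu]_x (r x)%:E))%:E.
  by rewrite fineK// ge0_fin_numE// integral_ge0// => x _; rewrite lee_fin.
set J := fine _ in rJ.
have J0 : (0 <= J)%R by rewrite fine_ge0// integral_ge0// => x _; rewrite lee_fin.
pose C : R := (L * m%:R)%R.
have C0 : (0 <= C)%R by rewrite mulr_ge0.
have C10 : (0 < C + 1)%R by lra.
(* The first bound leaves [eta / 2] for the measure of the new exceptional set; the second keeps [C]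
   times the average of [omega] below [eta / 4], also when [C] is zero. The threshold on [n] makes
   the boundary term of the integral at most [b]. *)
exists (Num.min (eta / 2) (eta / 4 / (C + 1)))%R,
  (Num.truncn (C * m%:R * J / b)).+1; split.
  by rewrite lt_min !divr_gt0.
move=> n k nn0 n0 dec.
have nR0 : (0 < n%:R :> R)%R by rewrite ltr0n.
pose F x := (n%:R^-1 * (birkhoff_sum T g n x +
   C * birkhoff_sum T r m (iter n T x)))%R.
have [mTn _] := measure_preserving_iter n hT.
have mFg : measurable_fun setT (birkhoff_sum T g n).
  exact: measurable_birkhoff_sum hT mg.
have mFr : measurable_fun setT (birkhoff_sum T r m).
  exact: measurable_birkhoff_sum hT mr.
have mFrn : measurable_fun setT (fun x => birkhoff_sum T r m (iter n T x)).
  exact: measurableT_comp.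
have mFrC : measurable_fun setT (fun x => C * birkhoff_sum T r m (iter n T x))%R.
  exact: measurable_funM.
have bg0 x : (0 <= birkhoff_sum T g n x)%R by exact: birkhoff_sum_ge0.
have br0 x : (0 <= birkhoff_sum T r m x)%R by exact: birkhoff_sum_ge0.
have bC0 x : (0 <= C * birkhoff_sum T r m (iter n T x))%R by rewrite mulr_ge0.
have mF : measurable_fun setT F.
  by apply: measurable_funM => //; exact: measurable_funD.
have F0 x : (0 <= F x)%R by rewrite mulr_ge0 ?invr_ge0// addr_ge0.
have intF : \int[mu]_x (F x)%:E <= (eta / 8 * (eta / 4))%:E.
  rewrite ge0_integralZ_EFin ?invr_ge0//; [|exact: measurable_funD|]; last first.
    by move=> x; rewrite addr_ge0.
  rewrite ge0_integralD_EFin// ge0_integralZ_EFin//.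
  rewrite (ge0_integral_iter n hT)// !integral_birkhoff_sum// rJ.
  apply: (@le_trans _ _ (n%:R^-1%:E * (n%:R%:E * b%:E + C%:E * (m%:R%:E * J%:E)))).
    rewrite lee_pmul2l ?lte_fin ?invr_gt0// leeD2r// lee_pmul2l// ?lte_fin//.
  rewrite -!EFinM lee_fin mulrDr mulKf ?gt_eqF//.
  have : (C * m%:R * J / b <= n%:R)%R.
    by rewrite ltW// (lt_le_trans (truncnS_gt _))// ler_nat.
  rewrite ler_pdivrMr// => h.
  have : (n%:R^-1 * (C * (m%:R * J)) <= b)%R by rewrite ler_pdivrMl// mulrA.
  by rewrite /b; lra.
(* Both domination inequalities must hold at every time of the orbit. *)
pose X3 := \bigcap_j (iter j T @^-1` (X1 `&` X2)).
have mX12 : measurable (X1 `&` X2) by exact: measurableI.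
have mTX j : measurable (iter j T @^-1` (X1 `&` X2)).
  by apply: measurable_preimage => //; case: (measure_preserving_iter j hT).
have mX3 : measurable X3 by exact: bigcapT_measurable.
have X31 : mu X3 = 1.
  apply: full_bigcap => // j; have [_ ->//] := measure_preserving_iter j hT.
  exact: full_setI.
have mFs : measurable [set x | (eta / 8 <= F x)%R].
  rewrite (_ : [set _ | _] = setT `&` F @^-1` `[(eta / 8)%R, +oo[).
    exact: mF.
  by apply/seteqP; split => x /=; rewrite in_itv/= andbT; [|case].
pose E := [set x | (eta / 8 <= F x)%R] `|` ~` X3.
have mE : measurable E by apply: measurableU => //; exact: measurableC.
have Eeta : mu E < (eta / 2)%:E.
  apply: (@le_lt_trans _ _ (eta / 4)%:E); last by rewrite lte_fin; lra.
  apply: (le_trans (probabilityU2 _ _ _)) => //; first exact: measurableC.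
  rewrite full_setC0// adde0; apply: markov_lt => //.
apply: (decomposition_transfer mE Eeta _ _ _ dec (c := (6 / 8 * eta)%R)).
- by rewrite [leRHS]splitr lerD2r ge_min lexx.
- by apply/andP; split; lra.
move=> x y /not_orP[Fx /contrapT X3x] /not_orP[Fy /contrapT X3y].
rewrite lt_min => /andP[_]; rewrite ltr_pdivlMr// => xy.
have {Fx}Fx : (F x < eta / 8)%R by rewrite ltNge; apply/negP.
have {Fy}Fy : (F y < eta / 8)%R by rewrite ltNge; apply/negP.
have avg0 : (0 <= averaged T n omega x y)%R.
  by rewrite mulr_ge0 ?invr_ge0//; exact: sumr_ge0.
suff : (averaged T n rho x y <= a + C * averaged T n omega x y + (F x + F y))%R.
  by rewrite /a; lra.
rewrite /averaged.
apply: (@le_trans _ _ (n%:R^-1 * \sum_(j < n) (a +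
    L * orbit_sum T omega m (iter j T x) (iter j T y) +
    (g (iter j T x) + g (iter j T y)))))%R.
  rewrite ler_pM2l ?invr_gt0//; apply: ler_sum => j _.
  by apply: Hrho; [case: (X3x j I)|case: (X3y j I)].
have := @orbit_sum_orbit_sum_le _ _ T omega r m n x y omega0.
have omk j : (omega (iter j T x) (iter j T y) <= r (iter j T x) + r (iter j T y))%R.
  by apply: omr; [case: (X3x j I)|case: (X3y j I)].
move=> /(_ omk) /(ler_wpM2l L0) H.
rewrite !big_split/= -[X in (_ * (_ + X + _))%R]mulr_sumr sumr_const card_ord -(mulr_natl a n).
rewrite -/(birkhoff_sum T g n x) -/(birkhoff_sum T g n y).
apply: (@le_trans _ _ (n%:R^-1 * (n%:R * a + L * (m%:R *
   (orbit_sum T omega n x y + (birkhoff_sum T r m (iter n T x) +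
     birkhoff_sum T r m (iter n T y)))) +
   (birkhoff_sum T g n x + birkhoff_sum T g n y)))%R).
  by rewrite ler_pM2l ?invr_gt0// lerD2r lerD2l.
rewrite /F -/(orbit_sum T omega n x y) /C le_eqVlt; apply/orP; left; apply/eqP.
by field; rewrite gt_eqF.
Qed.

End comparison.

(** * Comparison for small times *)

(** A single [c] strictly below [e] survives sums and a new supremum, whereas pointwise strict
    bounds would not. *)
Lemma diam_lt_bound (X : Type) (R : realType) (rho : X -> X -> R) (A : set X)
    (e : R) : diam rho A < e%:E ->
  exists2 c : R, (0 <= c < e)%R & forall x y, A x -> A y -> (rho x y <= c)%R.
Proof.
move=> Ae; have d0 : 0 <= diam rho A by rewrite /diam le_max lexx.
have dE : diam rho A = (fine (diam rho A))%:E.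
  by rewrite fineK// ge0_fin_numE// (lt_trans Ae) ?ltry.
exists (fine (diam rho A)); first by rewrite -!lee_fin -lte_fin -dE d0.
move=> x y Ax Ay; rewrite -lee_fin -dE /diam le_max; apply/orP; right.
by apply: ereal_sup_ubound; exists (x, y).
Qed.

Section decompositions.
Context d (X : measurableType d) (R : realType) (mu : probability X R).
Implicit Types (sigma tau rho : X -> X -> R) (T : X -> X).

Lemma has_decomposition_le sigma rho (delta e : R) k :
  (forall x y, (rho x y <= sigma x y)%R) -> (delta <= e)%R ->
  has_decomposition mu sigma delta k -> has_decomposition mu rho e k.
Proof.
move=> le_rs de [k0 [A [mA AT A0 Ad]]]; split => //; exists A; split => //.
  by rewrite (lt_le_trans A0)// lee_fin.
move=> i ik; have [c /andP[c0 ce] Ac] := diam_lt_bound (Ad i ik).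
apply: (@le_lt_trans _ _ c%:E); last by rewrite lte_fin (lt_le_trans ce).
by apply: diam_le => // x y Ax Ay; apply: le_trans (Ac _ _ Ax Ay).
Qed.

Lemma has_decomposition_add sigma tau (a b : R) k l :
  has_decomposition mu sigma a k -> has_decomposition mu tau b l ->
  has_decomposition mu (fun x y => sigma x y + tau x y)%R (a + b)%R (k * l).
Proof.
move=> [k0 [A [mA AT A0 Ad]]] [l0 [B [mB BT B0 Bd]]].
split; first by rewrite muln_gt0 k0.
have idx p : (p < k * l)%N -> (p %/ l < k)%N /\ (p %% l < l)%N.
  by move=> pkl; rewrite ltn_divLR// pkl ltn_pmod.
(* The common refinement: index 0 collects both exceptional sets, and [p'] below [k * l] encodes a
   pair of pieces by quotient and remainder. *)
exists (fun p => if p is p'.+1 then A (p' %/ l).+1 `&` B (p' %% l).+1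
                 else A 0%N `|` B 0%N); split.
- move=> [_|p /idx[pk pl]]; first by apply: measurableU; [exact: mA|exact: mB].
  by apply: measurableI; [exact: mA|exact: mB].
- apply/seteqP; split => // x _.
  have : (\bigcup_(i in [set i | (i <= k)%N]) A i) x by rewrite AT.
  move=> [[|i] /= ik Ax]; first by exists 0%N => //; left.
  have : (\bigcup_(i in [set i | (i <= l)%N]) B i) x by rewrite BT.
  move=> [[|j] /= jl Bx]; first by exists 0%N => //; right.
  exists (i * l + j).+1 => /=.
    rewrite (@leq_trans (i.+1 * l))// ?leq_mul2r ?ik ?orbT//.
    by rewrite mulSn addnC -addSn leq_add2r.
  by rewrite divnMDl// divn_small// addn0 modnMDl modn_small.
- by apply: measureU_lt => //; [exact: mA|exact: mB].
- move=> [//|p] /= /idx[pk pl].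
  have [c1 /andP[c10 c1a] Ac] := diam_lt_bound (Ad _ (pk : (0 < _.+1 <= k)%N)).
  have [c2 /andP[c20 c2b] Bc] := diam_lt_bound (Bd _ (pl : (0 < _.+1 <= l)%N)).
  apply: (@le_lt_trans _ _ (c1 + c2)%:E); last by rewrite lte_fin ltrD.
  apply: diam_le; first exact: addr_ge0.
  by move=> x y [Ax Bx] [Ay By]; rewrite lerD ?Ac ?Bc.
Qed.

Lemma has_decomposition_iter T rho (e : R) k n : measure_preserving mu T ->
  has_decomposition mu rho e k ->
  has_decomposition mu (fun x y => rho (iter n T x) (iter n T y)) e k.
Proof.
move=> hT [k0 [A [mA AT A0 Ad]]]; have [mTn muTn] := measure_preserving_iter n hT.
split => //; exists (fun i => iter n T @^-1` A i); split.
- by move=> i ik; apply: measurable_preimage => //; exact: mA.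
- apply/seteqP; split => // x _.
  have : (\bigcup_(i in [set i | (i <= k)%N]) A i) (iter n T x) by rewrite AT.
  by move=> [i ik Ax]; exists i.
- by rewrite muTn//; exact: mA.
- move=> i ik; have [c /andP[c0 ce] Ac] := diam_lt_bound (Ad i ik).
  apply: (@le_lt_trans _ _ c%:E); last by rewrite lte_fin.
  by apply: diam_le => // x y Ax Ay; exact: Ac.
Qed.

(** The length is [n.+1] because length zero would require a decomposition at scale zero, which
    cannot exist. *)
Lemma has_decomposition_orbit_sum T rho (e : R) k n : measure_preserving mu T ->
  has_decomposition mu rho e k ->
  has_decomposition mu (orbit_sum T rho n.+1) (n.+1%:R * e)%R (k ^ n.+1).
Proof.
move=> hT dec; elim: n => [|n IH].
  rewrite mul1r expn1; apply: has_decomposition_le dec => // x y.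
  by rewrite /orbit_sum big_ord1.
have := has_decomposition_add IH (has_decomposition_iter n.+1 hT dec).
rewrite -expnSr -[X in (_ * e + X)%R]mul1r -mulrDl natr1.
by apply: has_decomposition_le => // x y; rewrite /orbit_sum big_ord_recr.
Qed.

(** The count [k ^ n] is crude, but it yields finite entropy at each fixed [n], and for [k = 1] it
    stays 1. *)
Lemma has_decomposition_averaged T rho (e : R) k n : measure_preserving mu T ->
  (forall x y, (0 <= rho x y)%R) -> (0 < n)%N ->
  has_decomposition mu rho (e / n%:R)%R k ->
  has_decomposition mu (averaged T n rho) e (k ^ n).
Proof.
case: n => // n hT rho0 _ /(has_decomposition_orbit_sum n hT).
apply: has_decomposition_le => [x y|].
  rewrite ler_piMl//; first exact: orbit_sum_ge0.
  by rewrite invf_le1// ler1n.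
by rewrite mulrC divfK.
Qed.

Lemma epsilon_entropy_le rho (e : R) k : has_decomposition mu rho e k ->
  epsilon_entropy mu rho e <= (log2 k%:R)%:E.
Proof.
move=> dec; rewrite /epsilon_entropy; case: pselect => [h|]; last first.
  by case; exists k; apply/asboolP.
case: ex_minnP => l /asboolP[l0 _] /(_ k) lk; rewrite lee_fin /log2.
rewrite ler_pM2r ?invr_gt0 ?ln_gt0 ?ltr1n//.
have {}lk : (l <= k)%N by apply: lk; exact/asboolP.
by rewrite ler_ln ?posrE ?ltr0n ?ler_nat// (leq_trans l0).
Qed.

Lemma epsilon_entropy_ge0 rho (e : R) : 0 <= epsilon_entropy mu rho e.
Proof.
rewrite /epsilon_entropy; case: pselect => [h|_]; last exact: leey.
case: ex_minnP => l /asboolP[l0 _] _; rewrite lee_fin /log2.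
by rewrite divr_ge0// ln_ge0// ler1n.
Qed.

Lemma epsilon_entropy_ge1 rho (e : R) : ~ has_decomposition mu rho e 1 ->
  1 <= epsilon_entropy mu rho e.
Proof.
move=> ndec; rewrite /epsilon_entropy; case: pselect => [h|_]; last exact: leey.
case: ex_minnP => l /asboolP ldec _; rewrite lee_fin /log2.
have l2 : (2 <= l)%N.
  by move: ldec; case: l => [[]//|[|//]] /ndec.
by rewrite ler_pdivlMr ?ln_gt0 ?ltr1n// mul1r ler_ln ?posrE ?ltr0n ?ler_nat// ltnW.
Qed.

Lemma le_epsilon_entropy sigma rho (delta e : R) :
  (forall k, has_decomposition mu sigma delta k -> has_decomposition mu rho e k) ->
  epsilon_entropy mu rho e <= epsilon_entropy mu sigma delta.
Proof.
move=> H; rewrite [leRHS]/epsilon_entropy; case: pselect => [h|_]; last exact: leey.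
by case: ex_minnP => l /asboolP/H ldec _; exact: epsilon_entropy_le.
Qed.

End decompositions.

Section small_times.
Context d (X : measurableType d) (R : realType) (mu : probability X R).
Variables (T : X -> X) (rho omega : X -> X -> R).
Hypothesis hmu : standard_probability mu.
Hypothesis hT : measure_preserving mu T.
Hypothesis rho_semimetric : measurable_semimetric mu rho.
Hypothesis rho_admissible : admissible mu rho.
Hypothesis omega_semimetric : measurable_semimetric mu omega.
Hypothesis omega_admissible : admissible mu omega.
Hypothesis omega_generating : generating mu T omega.

Let omega0 x y : (0 <= omega x y)%R. Proof. by case: omega_semimetric. Qed.
Let rho0 x y : (0 <= rho x y)%R. Proof. by case: rho_semimetric. Qed.

(* When the right-hand side of the comparison at time [n] vanishes for every
   [delta], no constant [C] helps and the left-hand side has to vanish too. *)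
Lemma trivial_decomposition n : (0 < n)%N ->
  (forall e : R, (0 < e)%R -> has_decomposition mu (averaged T n omega) e 1) ->
  forall e : R, (0 < e)%R -> has_decomposition mu (averaged T n rho) e 1.
Proof.
move=> n0 tn.
(* The time-zero term of the average gives that [omega] is at most [n] times its average. *)
have tomega e : (0 < e)%R -> has_decomposition mu omega e 1.
  move=> e0; have e20 : (0 < e / 2)%R by rewrite divr_gt0.
  have nR : (1 <= n%:R :> R)%R by rewrite ler1n.
  have nR0 : (0 < n%:R :> R)%R by rewrite ltr0n.
  have dec : has_decomposition mu (averaged T n omega) (e / 2 / n%:R)%R 1.
    by apply: tn; rewrite divr_gt0.
  apply: (decomposition_transfer (E := set0) (s := (e / 2)%R) (c := (e / 2)%R)
    _ _ _ _ _ dec) => //.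
  - by rewrite measure0 lte_fin.
  - by rewrite [leRHS]splitr lerD2r ler_piMr ?invf_le1// ltW.
  - by apply/andP; split; lra.
  move=> x y _ _; rewrite ltr_pdivlMr// /averaged mulrAC mulVf ?gt_eqF// mul1r => xy.
  apply/ltW/(le_lt_trans _ xy); exact: (@orbit_sum_nth _ _ T omega n 0).
have trho e : (0 < e)%R -> has_decomposition mu rho e 1.
  move=> e0; have e20 : (0 < e / 2)%R by rewrite divr_gt0.
  have [delta [m [E [d0 mE Ee HE]]]] := controlled_semimetric hT
    omega_semimetric omega_admissible omega_generating hmu rho_admissible e20 e20.
  (* A one-piece decomposition for [omega] at scale [t / m.+1] gives one for the orbit sum at scale
     [t]; on that piece, off [E], control makes [rho] small. *)
  pose t : R := Num.min delta (e / 2)%R.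
  have t0 : (0 < t)%R by rewrite lt_min d0.
  have tm0 : (0 < t / m.+1%:R)%R by rewrite divr_gt0.
  have tE : (m.+1%:R * (t / m.+1%:R) = t)%R by rewrite mulrC divfK.
  have := has_decomposition_orbit_sum m hT (tomega _ tm0).
  rewrite exp1n tE => dec.
  apply: (decomposition_transfer (c := (e / 2)%R) mE Ee _ _ _ dec).
  - by rewrite [leRHS]splitr lerD2r ge_min lexx orbT.
  - by apply/andP; split; lra.
  - move=> x y Ex Ey; rewrite lt_min => /andP[xy _]; apply/ltW/HE => //.
    by apply: le_lt_trans xy; exact: le_orbit_sum.
move=> e e0; rewrite -(exp1n n); apply: has_decomposition_averaged => //.
by apply: trho; rewrite divr_gt0// ltr0n.
Qed.

(** If some scale [delta] admits no one-piece decomposition for [omega], its entropy is at least 1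
    there and a constant absorbs the finite left-hand side. Otherwise the left-hand side is zero by
    [trivial_decomposition]. *)
Lemma averaged_entropy_le (eta : R) n : (0 < eta)%R -> (0 < n)%N ->
  exists delta C : R, [/\ (0 < delta)%R, (0 < C)%R &
    epsilon_entropy mu (averaged T n rho) eta <=
    C%:E * epsilon_entropy mu (averaged T n omega) delta].
Proof.
move=> eta0 n0.
have [triv|] := pselect (forall e : R, (0 < e)%R ->
    has_decomposition mu (averaged T n omega) e 1).
  exists 1%R, 1%R; split => //.
  have := epsilon_entropy_le (trivial_decomposition n0 triv eta0).
  rewrite /log2 ln1 mul0r => /le_trans; apply.
  by rewrite mul1e epsilon_entropy_ge0.
move=> /existsNP[delta /not_implyP[delta0 /epsilon_entropy_ge1 H1]].
have en0 : (0 < eta / n%:R)%R by rewrite divr_gt0// ltr0n.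
have [k dec] := epsilon_entropy_decomposition (rho_admissible en0).
have := epsilon_entropy_le (has_decomposition_averaged hT rho0 n0 dec).
set l := log2 _ => Hl.
have l0 : (0 <= l)%R by rewrite -lee_fin (le_trans _ Hl)// epsilon_entropy_ge0.
exists delta, (l + 1)%R; split => //; first by rewrite ltr_wpDl.
apply: (le_trans Hl); apply: (@le_trans _ _ (l + 1)%:E).
  by rewrite lee_fin lerDl.
by rewrite -[leLHS]mule1 lee_pmul2l// lte_fin ltr_wpDl.
Qed.

Lemma averaged_entropy_small (eta : R) N : (0 < eta)%R ->
  exists delta C : R, [/\ (0 < delta)%R, (0 < C)%R &
    forall n, (0 < n < N)%N -> epsilon_entropy mu (averaged T n rho) eta <=
      C%:E * epsilon_entropy mu (averaged T n omega) delta].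
Proof.
move=> eta0; elim: N => [|N [a [C [a0 C0 IH]]]].
  by exists 1%R, 1%R; split => // n; rewrite andbF.
have [->|N0] := posnP N.
  by exists 1%R, 1%R; split => // -[].
have [b [D [b0 D0 HN]]] := averaged_entropy_le eta0 N0.
exists (Num.min a b), (C + D)%R; split.
- by rewrite lt_min a0.
- exact: addr_gt0.
move=> n /andP[n1]; rewrite ltnS leq_eqVlt => /orP[/eqP ->|nN].
- apply/(le_trans HN)/lee_pmul; rewrite ?lee_fin ?epsilon_entropy_ge0 ?(ltW D0)//.
    by rewrite lerDr ltW.
  apply: le_epsilon_entropy => k; apply: has_decomposition_le => //.
  by rewrite ge_min lexx orbT.
- apply/(le_trans (IH n _))/lee_pmul; rewrite ?n1 ?lee_fin ?epsilon_entropy_ge0 ?(ltW C0)//.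
    by rewrite lerDl ltW.
  apply: le_epsilon_entropy => k; apply: has_decomposition_le => //.
  by rewrite ge_min lexx.
Qed.

End small_times.

Lemma fun_preceq_trans (R : realType) (Phi Psi Omega : nat -> R -> \bar R) :
  fun_preceq Phi Psi -> fun_preceq Psi Omega -> fun_preceq Phi Omega.
Proof.
move=> PhiPsi PsiOmega e /PhiPsi[a /PsiOmega[b b0 [D D0 HD]] [C C0 HC]].
exists b => //; exists (C * D)%R; first exact: mulr_gt0.
move=> n n0; apply: (le_trans (HC n n0)).
by rewrite EFinM -muleA lee_pmul2l// HD.
Qed.

Lemma fun_equiv_class (R : realType) (Phi Psi : nat -> R -> \bar R) :
  fun_equiv Phi Psi -> Defs.equiv_class Phi = Defs.equiv_class Psi.
Proof.
move=> [PhiPsi PsiPhi]; apply/seteqP; split => Omega [HO [H1 H2]]; split => //.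
- by split; [exact: fun_preceq_trans H1|exact: fun_preceq_trans PhiPsi].
- by split; [exact: fun_preceq_trans H1|exact: fun_preceq_trans PsiPhi].
Qed.

Lemma averaged_entropy_preceq d (X : measurableType d) (R : realType)
    (mu : probability X R) (T : X -> X) (rho omega : X -> X -> R) :
  standard_probability mu -> measure_preserving mu T ->
  measurable_semimetric mu rho -> admissible mu rho -> finite_integral mu rho ->
  measurable_semimetric mu omega -> admissible mu omega ->
  generating mu T omega -> finite_integral mu omega ->
  fun_preceq (fun n e => epsilon_entropy mu (averaged T n rho) e)
             (fun n e => epsilon_entropy mu (averaged T n omega) e).
Proof.
move=> hmu hT rs ra ri os oa og oi e e0.
have [a [N [a0 large]]] :=
  averaged_decomposition_large hmu hT rs ra ri os oa og oi e0.
have [b [C [b0 C0 small]]] := averaged_entropy_small hmu hT rs ra os oa og N e0.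
exists (Num.min a b); first by rewrite lt_min a0.
exists (1 + C)%R; first exact: addr_gt0.
move=> n n0; have [nN|Nn] := ltnP n N.
- apply/(le_trans (small n _))/lee_pmul; rewrite ?n0//.
  + by rewrite lee_fin ltW.
  + exact: epsilon_entropy_ge0.
  + by rewrite lee_fin lerDr.
  apply: le_epsilon_entropy => k; apply: has_decomposition_le => //.
  by rewrite ge_min lexx orbT.
- apply: (@le_trans _ _ (1%:E * epsilon_entropy mu (averaged T n omega) a)).
    by rewrite mul1e; apply: le_epsilon_entropy => k; exact: large.
  apply: lee_pmul => //.
  + exact: epsilon_entropy_ge0.
  + by rewrite lee_fin lerDl ltW.
  apply: le_epsilon_entropy => k; apply: has_decomposition_le => //.
  by rewrite ge_min lexx.
Qed.

Theorem corollary1 (R : realType) (d : measure_display) (X : measurableType d)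
    (mu : probability X R) (T : X -> X) (rho omega : X -> X -> R)
    (hmu : standard_probability mu)
    (hT : invertible_measure_preserving mu T)
    (rho_semimetric : measurable_semimetric mu rho)
    (rho_admissible : admissible mu rho)
    (rho_generating : generating mu T rho)
    (rho_integral : finite_integral mu rho)
    (omega_semimetric : measurable_semimetric mu omega)
    (omega_admissible : admissible mu omega)
    (omega_generating : generating mu T omega)
    (omega_integral : finite_integral mu omega) :
  scaling_entropy mu T rho = scaling_entropy mu T omega.
Proof.
have {}hT : measure_preserving mu T by case: hT.
by apply: fun_equiv_class; split; exact: averaged_entropy_preceq.
Qed.
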